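(* The Wiener index $W(G)$ and the Szeged index $Sz(G)$ of a $C_4C_8$ system $G$ with $n$ vertices can be computed in $O(n)$ time.
   Context: The infinite $C_4C_8$ net is the infinite plane graph of the tiling of the plane by regular octagons and squares (truncated square tiling). For a cycle $Z$ of the net, the $C_4C_8$ system determined by $Z$ is the subgraph consisting of the vertices and edges on $Z$ or in its interior; the system is given together with its embedding in the net. Wiener index: $W(G)=\sum_{\{u,v\}\subseteq V(G)}d_G(u,v)$. For an edge $e=uv$, $n_1(e|G)$ (resp. $n_2(e|G)$) is the number of vertices strictly closer to $u$ than to $v$ (resp. strictly closer to $v$ than to $u$); Szeged index: $Sz(G)=\sum_{e\in E(G)}n_1(e|G)n_2(e|G)$. *)

(* Defs.v *)
From Stdlib Require Import Relation_Operators.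
From mathcomp Require Import all_boot all_order all_algebra.
Set Implicit Arguments.
Unset Strict Implicit.
Unset Printing Implicit Defensive.

(** * Distances, Wiener index, Szeged index of a graph on 'I_n *)

Section Indices.
Variables (n : nat) (e : rel 'I_n).

Definition walk (k : nat) (u v : 'I_n) : bool :=
  [exists p : k.-tuple 'I_n, path e u p && (last u p == v)].

(* Length of a shortest walk; a shortest walk visits each vertex at most once,
   so lengths below n suffice (the value is n when u and v are not connected). *)
Definition dist (u v : 'I_n) : nat := find (fun k => walk k u v) (iota 0 n).

Definition wiener : nat := \sum_(u < n) \sum_(v < n | u < v) dist u v.

Definition closer (u v : 'I_n) : nat := #|[set w | dist w u < dist w v]|.

Definition szeged : nat :=
  \sum_(u < n) \sum_(v < n | (u < v) && e u v) closer u v * closer v u.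

End Indices.

(** * The infinite C4C8 net *)

(* (x, y, k) is a corner of the square centred at the point (x, y) of the
   square lattice; k = 0, 1, 2, 3 is its east, north, west, south corner. *)
Definition netv : Type := (int * int * 'I_4)%type.

Definition corner (v : netv) : 'I_4 := v.2.

Definition mkv (x y : int) (k : nat) : netv := (x, y, inord k).

Definition link (v : netv) : netv :=
  let: (x, y, k) := v in
  match val k with
  | 0 => mkv (x + 1)%R y 2
  | 1 => mkv x (y + 1)%R 3
  | 2 => mkv (x - 1)%R y 0
  | _ => mkv x (y - 1)%R 1
  end.

(* The three neighbours of a vertex: the next and the previous corner of its
   square, counterclockwise, and the corner of the adjacent square. *)
Definition net_nb (s : nat) (v : netv) : netv :=
  let: (x, y, k) := v in
  match s with
  | 0 => (x, y, ordS k)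
  | 1 => (x, y, ord_pred k)
  | _ => link v
  end.

Definition net_adj : rel netv := fun u v => [exists s : 'I_3, net_nb s u == v].

(* (x, y, false) is the square centred at (x, y); (x, y, true) is the octagon
   surrounded by the squares centred at (x, y), (x + 1, y), (x + 1, y + 1)
   and (x, y + 1). *)
Definition netf : Type := (int * int * bool)%type.

(* Boundary of a face, counterclockwise. *)
Definition bd (f : netf) : seq netv :=
  let: (x, y, oct) := f in
  let x' := (x + 1)%R in
  let y' := (y + 1)%R in
  if oct then
    [:: mkv x y 0; mkv x' y 2; mkv x' y 1; mkv x' y' 3;
        mkv x' y' 2; mkv x y' 0; mkv x y' 3; mkv x y 1]
  else [:: mkv x y 0; mkv x y 1; mkv x y 2; mkv x y 3].

(* uv is an edge of the cycle c, given as the cyclic sequence of its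
   pairwise distinct vertices. *)
Definition cycle_edge (c : seq netv) (u v : netv) : bool :=
  [&& u \in c, v \in c & (next c u == v) || (next c v == u)].

Definition net_cycle (Z : seq netv) : Prop := ucycle net_adj Z /\ 2 < size Z.

(** * C4C8 systems *)

Section Interior.
Variable Z : seq netv.

(* Two faces that share an edge not on Z lie in the same component of the
   complement of Z in the plane. *)
Definition face_step (f g : netf) : Prop :=
  exists u v, [&& cycle_edge (bd f) u v, cycle_edge (bd g) u v
                & ~~ cycle_edge Z u v].

(* The interior of Z is the bounded component of its complement. *)
Definition inner_face (f : netf) : Prop :=
  exists B : nat, forall g : netf, clos_refl_trans netf face_step f g ->
    (`|g.1.1| <= B)%N /\ (`|g.1.2| <= B)%N.

Definition system_vertex (v : netv) : Prop :=
  v \in Z \/ exists2 f, inner_face f & v \in bd f.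

Definition system_edge (u v : netv) : Prop :=
  cycle_edge Z u v \/ exists2 f, inner_face f & cycle_edge (bd f) u v.

End Interior.

(* The graph e on 'I_n, embedded in the net by pos, is a C4C8 system whose
   vertices are numbered in an arbitrary order.  A system need not be an
   induced subgraph of the net, hence the separate condition on edges. *)
Definition C4C8_system (n : nat) (pos : 'I_n -> netv) (e : rel 'I_n) : Prop :=
  exists Z : seq netv,
    [/\ net_cycle Z,
        injective pos,
        forall v, system_vertex Z v <-> exists i, pos i = v
      & forall i j, e i j <-> system_edge Z (pos i) (pos j)].

(** * Word RAM *)

(* Structured programs over registers and a random access memory.  Words are
   natural numbers, subtraction is truncated, and a nonzero word is true. *)

Inductive expr :=
  | EConst of nat
  | EReg of nat
  | ELoad of expr
  | EAdd of expr & expr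
  | ESub of expr & expr
  | EMul of expr & expr.

Inductive com :=
  | CSkip
  | CSet of nat & expr           (* register := value *)
  | CStore of expr & expr         (* memory[address] := value *)
  | CSeq of com & com
  | CIf of expr & com & com
  | CWhile of expr & com.

Record state := State { regs : nat -> nat; ram : nat -> nat }.

Definition upd (f : nat -> nat) (a v : nat) : nat -> nat :=
  fun b => if b == a then v else f b.

Definition set_reg (s : state) r v := State (upd (regs s) r v) (ram s).
Definition set_ram (s : state) a v := State (regs s) (upd (ram s) a v).

(* Words, addresses included, are at most B; evaluation fails on overflow. *)
Definition word (B v : nat) : option nat := if v <= B then Some v else None.

Definition op2 (B : nat) (op : nat -> nat -> nat) (a b : option nat) :=
  obind (fun x => obind (fun y => word B (op x y)) b) a.

Fixpoint eval (B : nat) (s : state) (x : expr) : option nat :=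
  match x with
  | EConst k => word B k
  | EReg r => word B (regs s r)
  | ELoad a => obind (fun i => word B (ram s i)) (eval B s a)
  | EAdd a b => op2 B addn (eval B s a) (eval B s b)
  | ESub a b => op2 B subn (eval B s a) (eval B s b)
  | EMul a b => op2 B muln (eval B s a) (eval B s b)
  end.

Fixpoint cost (x : expr) : nat :=
  match x with
  | EConst _ | EReg _ => 1
  | ELoad a => (cost a).+1
  | EAdd a b | ESub a b | EMul a b => (cost a + cost b).+1
  end.

(* exec B c s t s': with words bounded by B, the program c started in state s
   halts after t steps in state s'.  A run that overflows does not halt. *)
Inductive exec (B : nat) : com -> state -> nat -> state -> Prop :=
  | ExecSkip s : exec B CSkip s 1 s
  | ExecSet r x s v : eval B s x = Some v ->
      exec B (CSet r x) s (cost x).+1 (set_reg s r v)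
  | ExecStore a x s i v : eval B s a = Some i -> eval B s x = Some v ->
      exec B (CStore a x) s (cost a + cost x).+1 (set_ram s i v)
  | ExecSeq c1 c2 s1 s2 s3 t1 t2 :
      exec B c1 s1 t1 s2 -> exec B c2 s2 t2 s3 ->
      exec B (CSeq c1 c2) s1 (t1 + t2) s3
  | ExecIf x c1 c2 s v t s' : eval B s x = Some v ->
      exec B (if v != 0 then c1 else c2) s t s' ->
      exec B (CIf x c1 c2) s ((cost x).+1 + t) s'
  | ExecWhileEnd x c s : eval B s x = Some 0 ->
      exec B (CWhile x c) s (cost x).+1 s
  | ExecWhile x c s1 v t1 s2 t2 s3 : eval B s1 x = Some v -> v != 0 ->
      exec B c s1 t1 s2 -> exec B (CWhile x c) s2 t2 s3 ->
      exec B (CWhile x c) s1 ((cost x).+1 + t1 + t2) s3.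

(** * The input: a graph together with its embedding in the net *)

Section Encoding.
Variables (n : nat) (pos : 'I_n -> netv) (e : rel 'I_n).

(* One more than the index of the neighbour of i in direction s, or 0 if the
   graph has no edge in that direction. *)
Definition slot (i : 'I_n) (s : nat) : nat :=
  if [pick j | e i j && (pos j == net_nb s (pos i))] is Some j then j.+1 else 0.

(* The number of vertices, followed by a record of four words per vertex: its
   corner and its neighbours in the three directions.  Since a system is
   connected, this determines pos up to a translation of the net. *)
Definition encode : seq nat :=
  n :: flatten [seq [:: val (corner (pos i)); slot i 0; slot i 1; slot i 2]
               | i <- enum 'I_n].

Definition input : state := State (fun=> 0) (nth 0 encode).

End Encoding.

(* Main.v *)
Require Import Defs.
From Stdlib Require Import Relation_Operators Classical.
From mathcomp Require Import all_boot all_order all_algebra zify.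
Set Implicit Arguments.
Unset Strict Implicit.
Unset Printing Implicit Defensive.
Import Order.TTheory GRing.Theory Num.Theory.

(** The edges of the net fall into families of parallel edges, each crossed by
    a straight line through squares and octagons.  In a system G, such a line
    is cut by the outer faces into segments, and each segment crosses a cut of
    G: the parity of the crossings of a ray from a face to infinity changes by
    the indicator of an edge, up to a coboundary, when the face is moved across
    that edge, and it is a coboundary on G for an outer face, since the face can
    be moved to infinity across edges outside G; telescoping along the segment
    shows that its set of edges is a coboundary.  Both shores of a cut are
    geodesics of the same length, because a suitable 1-Lipschitz function on the
    net increases along them.  Hence the two sides of the cut are the sets of
    vertices closer to either end of any of its edges, and the distance of two
    vertices is the number of cuts that separate them.  Therefore W(G) is the
    sum of n1 n2 over the cuts, and Sz(G) the sum of k n1 n2, where n1 and n2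
    are the sizes of the sides and k is the number of edges of the cut.

    The program builds a breadth-first search tree and its subtree sizes, and
    then walks along every cut.  The subtree sizes form a flow from the root in
    which every vertex absorbs one unit, so that the net flow across a cut is
    the number of vertices on the side away from the root.  A cut is met once in
    each direction; in one of them the net flow is negative, and truncated
    subtraction turns it into 0. *)

(** * The net: neighbours, faces and rays *)

(** The shape of the cycle enters the cut method through one property of rays, [cs_ray]. An outer
    face lies in an unbounded component, so crossing only edges outside G leads from it to a face
    beyond all coordinates of G, where a potential for the ray can be written down. Linear time has
    two sources. Height strictly increases along a segment, so a cut cannot close up: it has a first
    dart, which is recognised in constant time by the incomplete face on its right. Every dart of G
    lies on the chain of exactly one first dart, so trying each dart as a first dart and walking the
    chains costs a constant per dart, without marks on visited edges. Moreover, counting the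
    vertices on one side of a cut directly could take linear time for each cut, whereas the flow
    uses only data at the edges that the cut crosses. *)

Definition vx (v : netv) : int := v.1.1.
Definition vy (v : netv) : int := v.1.2.
Definition vk (v : netv) : nat := v.2.

Lemma netv_ext u v : vx u = vx v -> vy u = vy v -> vk u = vk v -> u = v.
Proof.
case: u => [[x y] k]; case: v => [[x' y'] k']; rewrite /vx /vy /vk /= => -> -> h.
by congr (_, _, _); apply: val_inj.
Qed.

Lemma vk_lt4 v : vk v < 4. Proof. exact: ltn_ord. Qed.

Lemma vx_mkv x y k : vx (mkv x y k) = x. Proof. by []. Qed.
Lemma vy_mkv x y k : vy (mkv x y k) = y. Proof. by []. Qed.
Lemma vk_mkv x y k : k < 4 -> vk (mkv x y k) = k.
Proof. by move=> h; rewrite /vk /= inordK. Qed.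

(* A dart is a vertex v with a slot s, directed to [net_nb s v]: [rs s] is the slot
   of the reverse dart, [nx s] that of the next dart on the boundary of the face
   on its left. *)
Definition rs (s : nat) : nat := match s with 0 => 1 | 1 => 0 | _ => s end.
Definition nx (s : nat) : nat := match s with 0 => 0 | 1 => 2 | _ => 1 end.

Lemma vk_nb s v : s < 3 ->
  vk (net_nb s v) = match s with 0 => (vk v).+1 %% 4 | 1 => (vk v + 3) %% 4
                    | _ => (vk v + 2) %% 4 end.
Proof.
case: v => [[x y] [k hk]]; case: s => [|[|[|//]]] _ //=.
- by rewrite /vk /=; lia.
- by case: k hk => [|[|[|[|//]]]] hk /=; rewrite vk_mkv.
Qed.

Lemma vx_nb s v : s < 3 ->
  vx (net_nb s v) = match s with 0 | 1 => vx v | _ =>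
    match vk v with 0 => vx v + 1 | 2 => vx v - 1 | _ => vx v end end%R.
Proof.
case: v => [[x y] [k hk]]; case: s => [|[|[|//]]] _ //=.
by case: k hk => [|[|[|[|//]]]] hk.
Qed.

Lemma vy_nb s v : s < 3 ->
  vy (net_nb s v) = match s with 0 | 1 => vy v | _ =>
    match vk v with 1 => vy v + 1 | 3 => vy v - 1 | _ => vy v end end%R.
Proof.
case: v => [[x y] [k hk]]; case: s => [|[|[|//]]] _ //=.
by case: k hk => [|[|[|[|//]]]] hk.
Qed.

Lemma netv_eqE (v w : netv) : (v == w) = [&& vx v == vx w, vy v == vy w & vk v == vk w].
Proof.
apply/eqP/and3P => [-> //| [/eqP h1 /eqP h2 /eqP h3]]; exact: netv_ext.
Qed.

(* The face on the left of a dart. *)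
Definition lface (v : netv) (s : nat) : netf :=
  match s with
  | 0 => (vx v, vy v, false)
  | 1 => match vk v with
         | 0 => (vx v, vy v - 1, true)
         | 1 => (vx v, vy v, true)
         | 2 => (vx v - 1, vy v, true)
         | _ => (vx v - 1, vy v - 1, true)
         end
  | _ => match vk v with
         | 0 => (vx v, vy v, true)
         | 1 => (vx v - 1, vy v, true)
         | 2 => (vx v - 1, vy v - 1, true)
         | _ => (vx v, vy v - 1, true)
         end
  end%R.

(* The dart (v, s) crosses the ray that leaves the face f to the east; from a
   square the ray first crosses the edge between the corners 0 and 1. *)
Definition ray (f : netf) (v : netv) (s : nat) : bool :=
  let: (x, y, oct) := f in
  [&& s == 2, (x < vx v)%R & ((vk v == 1) && (vy v == y))
        || ((vk v == 3) && (vy v == y + 1)%R)]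
  (+) [&& ~~ oct, vx v == x, vy v == y &
         ((vk v == 0) && (s == 0)) || ((vk v == 1) && (s == 1))].

Definition rface v s := lface (net_nb s v) (rs s).

Definition edge_of (w : netv) (t : nat) (v : netv) (s : nat) : bool :=
  (v == w) && (s == t) || (v == net_nb t w) && (s == rs t).

(* The rays of the two faces at the edge w t and this edge bound a half-row of
   squares, up to a few corners of the square of w. *)
Definition cutpot (w : netv) (t : nat) (v : netv) : bool :=
  match t, vk w with
  | 0, 1 => [&& vx v == vx w, vy v == vy w & vk v == 1]
  | 0, 2 => (vy v == vy w) && ((vx w < vx v)%R ||
               ((vx v == vx w) && ((vk v == 0) || (vk v == 3))))
  | 0, 3 => (vy v == vy w) && ((vx w < vx v)%R || ((vx v == vx w) && (vk v == 0)))
  | 2, 0 => (vy v == vy w) && (vx w < vx v)%R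
  | _, _ => false
  end.

(** The condition on [t] selects one of the two darts of each edge, which halves the potentials to
    be given. The rest is a finite check over corners and slots, with linear arithmetic for the
    coordinates. *)
Lemma ray_cutpot w t v s : s < 3 -> (t == 0) || (t == 2) && (vk w < 2) ->
  ray (lface w t) v s (+) ray (rface w t) v s (+) edge_of w t v s
  = cutpot w t v (+) cutpot w t (net_nb s v).
Proof.
move=> hs ht.
have ht3 : t < 3 by lia.
have hr3 : rs t < 3 by case: t ht ht3 => [|[|[|]]].
rewrite /edge_of !netv_eqE /rface /lface /cutpot !vx_nb // !vy_nb // !vk_nb //.
move: (vk_lt4 w) (vk_lt4 v).
case: t ht ht3 hr3 => [|[|[|//]]] //= + _ _;
case kw: (vk w) => [|[|[|[|//]]]] //= _ _;
case kv: (vk v) => [|[|[|[|//]]]] //= _; case: s hs => [|[|[|//]]] //= _;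
rewrite /ray ?kv /=; lia.
Qed.

Arguments net_nb : simpl never.
Arguments mkv : simpl never.
Arguments lface : simpl never.

Lemma mkvE v : v = mkv (vx v) (vy v) (vk v).
Proof. by apply: netv_ext => //; rewrite vk_mkv // vk_lt4. Qed.

Lemma netv_ind (P : netv -> Prop) :
  (forall x y, [/\ P (mkv x y 0), P (mkv x y 1), P (mkv x y 2) & P (mkv x y 3)]) ->
  forall v, P v.
Proof.
move=> h v; rewrite (mkvE v); have [] := h (vx v) (vy v).
by case: (vk v) (vk_lt4 v) => [|[|[|[|]]]].
Qed.

Lemma nb_mkv x y :
  (((net_nb 0 (mkv x y 0) = mkv x y 1) * (net_nb 0 (mkv x y 1) = mkv x y 2)) *
  ((net_nb 0 (mkv x y 2) = mkv x y 3) * (net_nb 0 (mkv x y 3) = mkv x y 0)) *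
  ((net_nb 1 (mkv x y 0) = mkv x y 3) * (net_nb 1 (mkv x y 1) = mkv x y 0)) *
  ((net_nb 1 (mkv x y 2) = mkv x y 1) * (net_nb 1 (mkv x y 3) = mkv x y 2)) *
  ((net_nb 2 (mkv x y 0) = mkv (x + 1)%R y 2) * (net_nb 2 (mkv x y 1) = mkv x (y + 1)%R 3)) *
  ((net_nb 2 (mkv x y 2) = mkv (x - 1)%R y 0) * (net_nb 2 (mkv x y 3) = mkv x (y - 1)%R 1)))%type.
Proof.
by do ?split; apply: netv_ext;
  rewrite ?vk_nb ?vx_nb ?vy_nb ?vk_mkv ?vx_mkv ?vy_mkv //= vk_mkv.
Qed.

Lemma slot_ind (P : nat -> Prop) : P 0 -> P 1 -> P 2 -> forall s, s < 3 -> P s.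
Proof. by move=> h0 h1 h2 [|[|[|]]]. Qed.

Lemma rs_lt3 s : s < 3 -> rs s < 3. Proof. by move: s; apply: slot_ind. Qed.
Lemma nx_lt3 s : nx s < 3. Proof. by case: s => [|[|]]. Qed.
Lemma rsK s : rs (rs s) = s. Proof. by case: s => [|[|]]. Qed.

Lemma nb_rs s v : s < 3 -> net_nb (rs s) (net_nb s v) = v.
Proof.
elim/netv_ind: v => x y; split; move: s; apply: slot_ind; rewrite /= ?nb_mkv //.
all: by apply: netv_ext; rewrite ?vk_mkv ?vx_mkv ?vy_mkv //; lia.
Qed.

Lemma nb_slot_inj s s' v : s < 3 -> s' < 3 -> net_nb s v = net_nb s' v -> s = s'.
Proof.
move=> h h' e; have := congr1 vk e; have := congr1 vx e; have := congr1 vy e.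
rewrite !vk_nb // !vx_nb // !vy_nb // {e}.
by move: (vk_lt4 v) s h s' h'; case: (vk v) => [|[|[|[|]]]] //= _;
  apply: slot_ind; apply: slot_ind => //=; lia.
Qed.

Definition nstep (d : netv * nat) : netv * nat := (net_nb d.2 d.1, nx d.2).

(* The number of steps from the tail of a dart along its left face to the head of
   the opposite edge, which is the tail of the parallel dart. *)
Definition face_half (s : nat) : nat := if s == 0 then 3 else 5.

Lemma lface_mkv x y k s : k < 4 ->
  lface (mkv x y k) s = match s with 0 => (x, y, false)
   | 1 => match k with 0 => (x, y - 1, true) | 1 => (x, y, true)
          | 2 => (x - 1, y, true) | _ => (x - 1, y - 1, true) end
   | _ => match k with 0 => (x, y, true) | 1 => (x - 1, y, true)
          | 2 => (x - 1, y - 1, true) | _ => (x, y - 1, true) end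
   end%R.
Proof. by move=> hk; rewrite /lface vk_mkv. Qed.

Lemma addrNK1 (x : int) : (((x + 1 - 1)%R = x) * ((x - 1 + 1)%R = x))%type.
Proof. by rewrite addrK subrK. Qed.

Lemma lface_nstep d : d.2 < 3 -> lface (nstep d).1 (nstep d).2 = lface d.1 d.2.
Proof.
case: d => v s /=; elim/netv_ind: v => x y; split; move: s; apply: slot_ind => /=;
by rewrite /nstep /= ?nb_mkv !lface_mkv //= ?addrNK1.
Qed.

Lemma nstep8 d : d.2 < 3 -> iter 8 nstep d = d.
Proof.
case: d => v s /=; elim/netv_ind: v => x y; split; move: s; apply: slot_ind;
by rewrite /nstep /= ?nb_mkv ?addrNK1.
Qed.

Definition facing (v : netv) (s : nat) : netv := (iter (face_half s) nstep (v, s)).1.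

(** The boundary of the face runs through the opposite edge against the parallel dart: the dart met
    there has slot [s] again, and its reverse is the parallel dart [(facing v s, rs s)]. *)
Lemma facing_head v s : s < 3 ->
  iter (face_half s).-1 nstep (v, s) = (net_nb (rs s) (facing v s), s).
Proof.
elim/netv_ind: v => x y; split; move: s; apply: slot_ind;
by rewrite /facing /nstep /= ?nb_mkv ?addrNK1.
Qed.

Lemma lface_iter k d : d.2 < 3 ->
  lface (iter k nstep d).1 (iter k nstep d).2 = lface d.1 d.2.
Proof.
move=> h; elim: k => [|k IH] //; rewrite iterS lface_nstep //.
by case: k {IH} => [|k] //; rewrite iterS nx_lt3.
Qed.

(** Consecutive darts of a cut share a face, on the left of the first and on the right of the
    second; this makes the rays cancel in [telescope]. *)
Lemma rface_facing v s : s < 3 -> rface (facing v s) (rs s) = lface v s.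
Proof.
by move=> h; rewrite /rface rsK -(lface_iter (face_half s).-1 (d := (v, s))) // facing_head.
Qed.

(** * Directions of darts and height functions *)

(* Multiples of 45 degrees, counterclockwise from the east. *)
Definition dir (v : netv) (s : nat) : nat :=
  match s with 0 => (vk v).*2 + 3 | 1 => (vk v).*2 + 5 | _ => (vk v).*2 end %% 8.

(* A 1-Lipschitz function that grows to the left of the direction q, at full
   speed along both shores of a cut crossed in this direction. *)
Definition height (q : nat) (v : netv) : int :=
  match (q %% 4)%N with
  | 0 => 3 * vy v + match vk v with 1 => 1 | 3 => -1 | _ => 0 end
  | 1 => 2 * (vy v - vx v) + match vk v with 1 | 2 => 1 | _ => 0 end
  | 2 => - (3 * vx v) + match vk v with 0 => -1 | 2 => 1 | _ => 0 end
  | _ => - (2 * (vx v + vy v)) + match vk v with 2 | 3 => 1 | _ => 0 end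
  end%R * (-1) ^+ (3 < q)%N.

Lemma dir_mkv x y k s : k < 4 -> dir (mkv x y k) s =
  match s with 0 => k.*2 + 3 | 1 => k.*2 + 5 | _ => k.*2 end %% 8.
Proof. by move=> hk; rewrite /dir vk_mkv. Qed.

Lemma height_mkv q x y k : k < 4 -> (height q (mkv x y k) =
  match (q %% 4)%N with
  | 0 => 3 * y + match k with 1 => 1 | 3 => -1 | _ => 0 end
  | 1 => 2 * (y - x) + match k with 1 | 2 => 1 | _ => 0 end
  | 2 => - (3 * x) + match k with 0 => -1 | 2 => 1 | _ => 0 end
  | _ => - (2 * (x + y)) + match k with 2 | 3 => 1 | _ => 0 end
  end * (-1) ^+ (3 < q)%N)%R.
Proof. by move=> hk; rewrite /height vk_mkv. Qed.

Arguments dir : simpl never.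
Arguments height : simpl never.

Lemma dir_lt8 v s : dir v s < 8. Proof. by rewrite /dir ltn_mod. Qed.

Lemma height_lip q v s : s < 3 -> (`|height q (net_nb s v) - height q v| <= 1)%R.
Proof.
rewrite /height; elim/netv_ind: v => x y; split; move: s; apply: slot_ind;
rewrite ?nb_mkv !vk_mkv // !vx_mkv !vy_mkv;
by have := ltn_pmod q (isT : 0 < 4); case: (q %% 4) => [|[|[|[|]]]] //= _; case: (3 < q) => /=; lia.
Qed.

Lemma height_head v s : s < 3 -> height (dir v s) (net_nb s v) = height (dir v s) v.
Proof.
elim/netv_ind: v => x y; split; move: s; apply: slot_ind;
by rewrite ?nb_mkv dir_mkv //= !height_mkv //=; lia.
Qed.

Lemma dir_rs v s : s < 3 -> dir (net_nb s v) (rs s) = (dir v s + 4) %% 8.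
Proof.
elim/netv_ind: v => x y; split; move: s; apply: slot_ind;
by rewrite ?nb_mkv !dir_mkv.
Qed.

Lemma dir_facing v s : s < 3 -> dir (facing v s) (rs s) = dir v s.
Proof.
elim/netv_ind: v => x y; split; move: s; apply: slot_ind;
by rewrite /facing /nstep /= ?nb_mkv ?dir_mkv.
Qed.

(** [face_half s - 2], which is 1 or 3, is also the number of edges between the two parallel edges
    on either shore, so the shores climb at full speed. *)
Lemma height_facing v s : s < 3 ->
  (height (dir v s) (facing v s) = height (dir v s) v + (face_half s - 2)%N%:Z)%R.
Proof.
elim/netv_ind: v => x y; split; move: s; apply: slot_ind;
by rewrite /facing /face_half /nstep /= ?nb_mkv ?dir_mkv // !height_mkv //=; lia.
Qed.

Lemma dir_nstep v s : s < 3 ->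
  dir (net_nb s v) (nx s) = (dir v s + (s == 0).+1) %% 8.
Proof.
elim/netv_ind: v => x y; split; move: s; apply: slot_ind;
by rewrite ?nb_mkv !dir_mkv.
Qed.

Lemma dir_iter k v s : s < 3 ->
  dir (iter k nstep (v, s)).1 (iter k nstep (v, s)).2
  = (dir v s + k * (s == 0).+1) %% 8.
Proof.
move=> hs; elim: k => [|k IH]; first by rewrite addn0 modn_small // dir_lt8.
have [h2 h3] : (iter k nstep (v, s)).2 < 3 /\ ((iter k nstep (v, s)).2 == 0) = (s == 0).
  elim: k {IH} => [|k [h2 h3]] //; rewrite iterS nx_lt3 -h3; split=> //.
  by rewrite /=; case: (iter k nstep (v, s)).2 => [|[|]].
by rewrite iterS /= dir_nstep // IH h3 modnDml mulSn addnA addnAC.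
Qed.

(** [(face_half s).*2 - 2] is the length of the boundary, 4 or 8, and [(face_half s).-1] the
    position of the opposite edge. Each step turns by 90 or 45 degrees, so no other boundary edge is
    parallel to the first one. *)
Lemma dir_ladder v s k : s < 3 -> 0 < k < (face_half s).*2 - 2 -> k != (face_half s).-1 ->
  dir (iter k nstep (v, s)).1 (iter k nstep (v, s)).2 %% 4 != dir v s %% 4.
Proof. by move=> hs; rewrite dir_iter // /face_half; case: (s == 0) => /=; lia. Qed.

Lemma ray_cob w t : t < 3 -> exists kap : netv -> bool, forall v s, s < 3 ->
  ray (lface w t) v s (+) ray (rface w t) v s (+) edge_of w t v s
  = kap v (+) kap (net_nb s v).
Proof.
move=> ht.
case h : ((t == 0) || (t == 2) && (vk w < 2)).
  by exists (cutpot w t) => v s hs; apply: ray_cutpot.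
(* The reverse dart has the same edge, exchanges the two faces, and satisfies the condition of
   [ray_cutpot]. *)
exists (cutpot (net_nb t w) (rs t)) => v s hs.
rewrite -ray_cutpot //; last first.
  rewrite vk_nb //; move: h; move: (vk_lt4 w).
  by case: t ht => [|[|[|]]] //= _; case: (vk w) => [|[|[|[|]]]].
by rewrite /rface /edge_of !nb_rs // !rsK orbC [ray _ _ _ (+) ray _ _ _]addbC.
Qed.

Lemma mkv_eqE x y k x' y' k' : k < 4 -> k' < 4 ->
  (mkv x y k == mkv x' y' k') = [&& k == k', x == x' & y == y'].
Proof.
by move=> h h'; rewrite netv_eqE !vk_mkv // !vx_mkv !vy_mkv andbA andbC.
Qed.

Lemma uniq_bd f : uniq (bd f).
Proof.
case: f => [[x y] []]; rewrite /bd /= !inE !mkv_eqE //=; lia.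
Qed.

Lemma next_bd f u : u \in bd f ->
  exists s, [/\ s < 3, next (bd f) u = net_nb s u & lface u s = f].
Proof.
move=> hu; rewrite next_nth hu; move/(nthP u): (hu) => [i hi <-].
rewrite index_uniq ?uniq_bd //.
case: f {hu} hi => [[x y] []] /=.
  case: i => [|[|[|[|[|[|[|[|i]]]]]]]] //= _; [exists 2|exists 1|exists 2|exists 1|exists 2|exists 1|exists 2|exists 1];
  by rewrite nb_mkv lface_mkv //= ?addrNK1.
by case: i => [|[|[|[|i]]]] //= _; exists 0; rewrite nb_mkv lface_mkv.
Qed.

Lemma cycle_edgeC c u v : cycle_edge c u v = cycle_edge c v u.
Proof. by rewrite /cycle_edge andbCA orbC. Qed.

Lemma cycle_edge_bd f u v : cycle_edge (bd f) u v ->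
  exists s, [/\ s < 3, v = net_nb s u & f = lface u s \/ f = rface u s].
Proof.
case/and3P => hu hv /orP[] /eqP.
  by have [s [hs -> hf]] := next_bd hu => <-; exists s; split=> //; left.
have [s [hs -> hf]] := next_bd hv => <-; exists (rs s).
by rewrite rs_lt3 // /rface rsK nb_rs //; split=> //; right.
Qed.

Lemma bd_cycle_edge v s : s < 3 -> cycle_edge (bd (lface v s)) v (net_nb s v).
Proof.
move=> hs; have hv : v \in bd (lface v s).
  move: s hs; elim/netv_ind: v => x y; split; apply: slot_ind;
  by rewrite lface_mkv //= /bd ?addrNK1 !inE eqxx ?orbT.
have [s' [hs' hn hf]] := next_bd hv.
have e : s' = s.
  move: s hs s' hs' hf {hv hn}; elim/netv_ind: v => x y; split; apply: slot_ind; apply: slot_ind;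
  by rewrite !lface_mkv //= => -[]; lia.
rewrite -{2}e -hn; apply/and3P; split => //; first by rewrite mem_next.
by rewrite eqxx.
Qed.

Lemma facing_facing v s : s < 3 -> facing (net_nb (rs s) (facing v s)) s = net_nb s v.
Proof.
elim/netv_ind: v => x y; split; move: s; apply: slot_ind;
by rewrite /facing /nstep /= ?nb_mkv ?addrNK1.
Qed.

Lemma face_half_back v s : s < 3 -> iter ((face_half s).*2 - 2) nstep (v, s) = (v, s).
Proof.
elim/netv_ind: v => x y; split; move: s; apply: slot_ind;
by rewrite /face_half /nstep /= ?nb_mkv ?addrNK1.
Qed.

(** * C4C8 systems *)

Section Neighbours.
Variables (n : nat) (pos : 'I_n -> netv) (e : rel 'I_n).

Definition nbr (i : 'I_n) (s : nat) : option 'I_n :=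
  [pick j | e i j && (pos j == net_nb s (pos i))].

Definition ostep (d : option 'I_n * nat) : option 'I_n * nat :=
  (obind (nbr^~ d.2) d.1, nx d.2).

(* Eight steps lead once around an octagon and twice around a square. *)
Definition left_full (i : 'I_n) (s : nat) : bool := (iter 8 ostep (Some i, s)).1.

(** A cochain modulo 2 on the darts of the graph that comes from a potential on vertices. The
    potential is a function on the whole net, as [cutpot] is. *)
Definition coboundary (h : netv -> nat -> bool) : Prop :=
  exists kap : netv -> bool, forall i j s, s < 3 -> e i j ->
    pos j = net_nb s (pos i) -> h (pos i) s = kap (pos i) (+) kap (pos j).

(* What the cut method uses of a C4C8 system. The last condition expresses that
   the system is simply connected: an incomplete face lies outside. *)
Record cut_system : Prop := CutSystem {
  cs_inj : injective pos;
  cs_net : forall i j, e i j -> exists2 s, s < 3 & pos j = net_nb s (pos i);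
  cs_sym : symmetric e;
  cs_connect : forall i j, connect e i j;
  cs_size : 2 < n;
  cs_ray : forall i s, s < 3 -> ~~ left_full i s ->
    coboundary (ray (lface (pos i) s)) }.

Lemma nbrP i j s : injective pos ->
  nbr i s = Some j <-> e i j /\ pos j = net_nb s (pos i).
Proof.
move=> inj; rewrite /nbr; case: pickP => [k /andP[h /eqP p]|h].
  split=> [[<-] //|[h' p']]; congr Some; apply: inj; congruence.
by split=> // -[h1 h2]; have := h j; rewrite h1 h2 eqxx.
Qed.

Lemma coboundary_add h1 h2 : coboundary h1 -> coboundary h2 ->
  coboundary (fun v s => h1 v s (+) h2 v s).
Proof.
move=> [k1 H1] [k2 H2]; exists (fun v => k1 v (+) k2 v) => i j s hs he hp.
by rewrite (H1 _ j) // (H2 _ j) //; do 4 case: (_ (pos _)).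
Qed.

Lemma coboundary_ext h1 h2 :
  (forall i j s, s < 3 -> e i j -> pos j = net_nb s (pos i) ->
     h1 (pos i) s = h2 (pos i) s) ->
  coboundary h1 -> coboundary h2.
Proof.
move=> H [k1 H1]; exists k1 => i j s hs he hp.
by rewrite -(H _ j) // (H1 _ j).
Qed.

End Neighbours.

(** * From the bounding cycle to the conditions of the cut method *)

Section SystemIsCutSystem.
Variables (n : nat) (pos : 'I_n -> netv) (e : rel 'I_n) (Z : seq netv).
Hypothesis Zcycle : net_cycle Z.
Hypothesis pos_inj : injective pos.
Hypothesis posV : forall v, system_vertex Z v <-> exists i, pos i = v.
Hypothesis posE : forall i j, e i j <-> system_edge Z (pos i) (pos j).

Local Notation reach := (clos_refl_trans netf (face_step Z)).

Lemma face_step_sym f g : face_step Z f g -> face_step Z g f.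
Proof. by move=> [u [v /and3P[h1 h2 h3]]]; exists u, v; rewrite h1 h2 h3. Qed.

Lemma inner_step f g : face_step Z f g -> inner_face Z f -> inner_face Z g.
Proof. by move=> h [B H]; exists B => x hx; apply: H; apply: rt_trans hx; apply: rt_step. Qed.

Lemma system_sym : symmetric e.
Proof.
move=> i j; apply/idP/idP => /posE h; apply/posE; case: h => [h|[f hf h]].
all: by [left; rewrite cycle_edgeC | right; exists f => //; rewrite cycle_edgeC].
Qed.

Lemma system_net i j : e i j -> exists2 s, s < 3 & pos j = net_nb s (pos i).
Proof.
move/posE; case=> [/and3P[hi hj h]|[f _ /cycle_edge_bd[s [hs h _]]]]; last by exists s.
have [/andP[Zc Zu] _] := Zcycle.
case/orP: h => /eqP h.
  have := next_cycle Zc hi; rewrite h => /existsP[s /eqP <-].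
  by exists s.
have := next_cycle Zc hj; rewrite h => /existsP[s /eqP <-].
by exists (rs s); rewrite ?rs_lt3 // nb_rs.
Qed.

(** An edge of the graph off Z belongs to some inner face; [f] has this edge on its boundary, so it
    would lie in the same component and be inner too. *)
Lemma edge_off f u v i j : ~ inner_face Z f -> cycle_edge (bd f) u v ->
  ~~ cycle_edge Z u v -> e i j -> ~ ((pos i = u /\ pos j = v) \/ (pos i = v /\ pos j = u)).
Proof.
move=> hf hb hz he H.
have hE : system_edge Z u v.
  case: H => -[<- <-]; apply/posE => //; by rewrite system_sym.
case: hE => [hZ|[g hg hge]]; first by rewrite hZ in hz.
apply: hf; apply: inner_step hg; exists u, v; by rewrite hge hb hz.
Qed.

Lemma ray_step f g : face_step Z f g -> ~ inner_face Z f ->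
  coboundary pos e (ray g) -> coboundary pos e (ray f).
Proof.
move=> [u [v /and3P[hf hg hz]]] nf cg.
have [s [hs ev ff]] := cycle_edge_bd hf.
have [s' [hs' ev' gg]] := cycle_edge_bd hg.
have es : s' = s by apply: (nb_slot_inj (v := u)) => //; rewrite -ev -ev'.
subst s'; have [kap hk] := ray_cob u hs.
have ck : coboundary pos e (fun v s' => ray (lface u s) v s' (+) ray (rface u s) v s').
  exists kap => i j t ht he hp; rewrite hp -hk //.
  suff -> : edge_of u s (pos i) t = false by rewrite addbF.
  apply/negP => /orP[] /andP[/eqP h1 /eqP h2]; apply: (edge_off nf hf hz he).
    by left; rewrite h1 hp ev h1 h2.
  by right; rewrite h1 hp h1 h2 nb_rs.
have [->//|nfg] := eqVneq f g.
have := coboundary_add ck cg; apply: coboundary_ext => i j t _ _ _.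
case: ff gg nfg => -> [] ->; rewrite ?eqxx // => _; by do 2 case: ray.
Qed.

Lemma ray_reach f g : reach f g -> ~ inner_face Z f ->
  (coboundary pos e (ray g) -> coboundary pos e (ray f)) /\ ~ inner_face Z g.
Proof.
elim=> {f g} [f g h nf|f nf|f g k _ IH1 _ IH2 nf] //.
  split; first exact: ray_step.
  by move=> ig; apply: nf; apply: inner_step ig; apply: face_step_sym.
by have [c1 n1] := IH1 nf; have [c2 n2] := IH2 n1; split=> // h; apply: c1; apply: c2.
Qed.

(** A ray that starts far to the west crosses all links between two rows of squares that the graph
    can contain, and these are the coboundary of a half-plane. Any other far ray misses the
    graph. *)
Lemma ray_far (B : nat) x y o :
  (forall i, (`|vx (pos i)| + 2 <= B)%N /\ (`|vy (pos i)| + 2 <= B)%N) ->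
  ~ ((`|x| <= B)%N /\ (`|y| <= B)%N) -> coboundary pos e (ray (x, y, o)).
Proof.
move=> HB far.
have [xneg|xpos] := boolP ((x < - B%:Z)%R).
  exists (fun v => (y < vy v)%R) => i j s hs he ->; rewrite vy_nb //.
  have [h1 h2] := HB i; move: (vk_lt4 (pos i)).
  by case kv: (vk (pos i)) => [|[|[|[|]]]] //= _; move: s hs; apply: slot_ind; rewrite /ray kv /=; lia.
exists (fun v => false) => i j s hs he _.
have [h1 h2] := HB i; rewrite /ray; lia.
Qed.

Lemma outer_ray f : ~ inner_face Z f -> coboundary pos e (ray f).
Proof.
move=> nf; pose B := (\sum_i (`|vx (pos i)| + `|vy (pos i)|) + 2)%N.
have HB i : (`|vx (pos i)| + 2 <= B)%N /\ (`|vy (pos i)| + 2 <= B)%N.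
  by rewrite /B (bigD1 i) //=; lia.
(* No bound works for an outer face; this is used for a [B] that exceeds all coordinates of the
   graph. *)
have [g ng] : exists g, ~ (reach f g -> (`|g.1.1| <= B)%N /\ (`|g.1.2| <= B)%N).
  by apply: not_all_ex_not => H; apply: nf; exists B.
have [hg far] := imply_to_and _ _ ng.
have [c _] := ray_reach hg nf; apply: c; case: g {ng} hg far => [[x y] o] hg far.
exact: ray_far far.
Qed.

Lemma inner_left_full i s : s < 3 -> inner_face Z (lface (pos i) s) -> left_full pos e i s.
Proof.
move=> hs hf.
suff H k : let d := iter k nstep (pos i, s) in
  exists2 j, pos j = d.1 & iter k (ostep pos e) (Some i, s) = (Some j, d.2).
  by have [j _ h] := H 8; rewrite /left_full h.
elim: k => [|k [j hj hk]] /=; first by exists i.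
set d := iter k nstep (pos i, s) in hj hk *.
have hd : d.2 < 3 by rewrite /d; case: (k) => [|k']; rewrite // iterS nx_lt3.
have hl : lface d.1 d.2 = lface (pos i) s by rewrite /d lface_iter.
have hb : cycle_edge (bd (lface (pos i) s)) (pos j) (net_nb d.2 (pos j)).
  by rewrite -hl hj bd_cycle_edge.
have [j' hj'] : exists j', pos j' = net_nb d.2 (pos j).
  by apply/posV; right; exists (lface (pos i) s) => //; case/and3P: hb.
have he : e j j' by apply/posE; right; exists (lface (pos i) s); rewrite // hj'.
exists j'; first by rewrite hj' hj.
rewrite hk /ostep /=; congr (_, _); exact/nbrP.
Qed.

Definition linked (u v : netv) : Prop :=
  exists i j, [/\ pos i = u, pos j = v & connect e i j].

Lemma linked_sym u v : linked u v -> linked v u.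
Proof.
move=> [i [j [hi hj h]]]; exists j, i; split=> //.
by rewrite (sym_connect_sym system_sym).
Qed.

Lemma linked_trans v u w : linked u v -> linked v w -> linked u w.
Proof.
move=> [i [j [hi hj h]]] [j' [k [hj' hk h']]].
have ej : j' = j by apply: pos_inj; rewrite hj.
by exists i, k; split=> //; apply: connect_trans h _; rewrite -ej.
Qed.

Lemma linked_edge u v : system_edge Z u v -> linked u v.
Proof.
move=> h; have [hu hv] : system_vertex Z u /\ system_vertex Z v.
  case: h => [/and3P[hu hv _]|[f hf /and3P[hu hv _]]]; first by split; left.
  by split; right; exists f.
have [/posV[i hi] /posV[j hj]] := conj hu hv.
by exists i, j; split=> //; apply: connect1; apply/posE; rewrite hi hj.
Qed.

Lemma linked_cycle c : uniq c ->
  (forall u v, cycle_edge c u v -> system_edge Z u v) ->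
  forall u v, u \in c -> v \in c -> linked u v.
Proof.
case: c => [//|z0 c] uc hc.
have hn k : k.+1 < size (z0 :: c) -> linked (nth z0 (z0 :: c) k) (nth z0 (z0 :: c) k.+1).
  move=> hk; apply: linked_edge; apply: hc.
  apply/and3P; split; rewrite ?mem_nth //; first exact: ltnW.
  by rewrite next_nth mem_nth ?index_uniq ?eqxx //; apply: ltnW.
have h0 : linked z0 z0.
  suff h : linked z0 (next (z0 :: c) z0) by apply: linked_trans h (linked_sym h).
  by apply: linked_edge; apply: hc; rewrite /cycle_edge mem_next mem_head eqxx.
have h k : k < size (z0 :: c) -> linked z0 (nth z0 (z0 :: c) k).
  elim: k => [//|k IH] hk; exact: linked_trans (IH (ltnW hk)) (hn _ hk).
move=> u v /(nthP z0)[k hk <-] /(nthP z0)[k' hk' <-].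
exact: linked_trans (linked_sym (h _ hk)) (h _ hk').
Qed.

Lemma linked_Z u v : u \in Z -> v \in Z -> linked u v.
Proof.
have [/andP[_ Zu] _] := Zcycle.
by apply: linked_cycle => // a b h; left.
Qed.

Lemma linked_inner f u v : inner_face Z f -> u \in bd f -> v \in bd f -> linked u v.
Proof.
by move=> hf; apply: (linked_cycle (uniq_bd f)) => a b h; right; exists f.
Qed.

(** One step of a walk through faces: either the edge lies on Z and its end serves as [z], or the
    face behind it belongs to the same component and the walk goes on. *)
Lemma linked_cross v s f : s < 3 -> lface v s = f -> inner_face Z f ->
  (face_step Z f (rface v s) -> exists2 z, z \in Z &
     forall u, u \in bd (rface v s) -> linked u z) ->
  exists2 z, z \in Z & forall u, u \in bd f -> linked u z.
Proof.
move=> hs ef hf IH.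
have hl := bd_cycle_edge v hs; rewrite ef in hl.
have hr : cycle_edge (bd (rface v s)) v (net_nb s v).
  by rewrite cycle_edgeC -{3}(nb_rs v hs) /rface bd_cycle_edge // rs_lt3.
have hv : v \in bd f by case/and3P: hl.
have [/and3P[hZ _ _]|hZ] := boolP (cycle_edge Z v (net_nb s v)).
  by exists v => // u hu; apply: linked_inner hf _ _.
have hg : face_step Z f (rface v s).
  by exists v, (net_nb s v); rewrite hl hr.
have [z hz H] := IH hg; exists z => // u hu.
apply: linked_trans (linked_inner hf hu hv) _; apply: H; by case/and3P: hr.
Qed.

(* Walking east from an inner face, one has to cross Z before leaving the
   bounded component. *)
Lemma inner_to_Z f : inner_face Z f ->
  exists2 z, z \in Z & forall u, u \in bd f -> linked u z.
Proof.
have oct m x y (B : nat) :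
    (forall g, reach (x, y, true) g -> (`|g.1.1| <= B)%N /\ (`|g.1.2| <= B)%N) ->
    (B%:Z - x < m%:Z)%R ->
    exists2 z, z \in Z & forall u, u \in bd (x, y, true) -> linked u z.
  elim: m x y => [|m IH] x y HB hm.
    by have /= [] := HB (x, y, true) (rt_refl _ _ _); lia.
  have er : rface (mkv (x + 1)%R y 1) 2 = ((x + 1)%R, y, true).
    by rewrite /rface nb_mkv lface_mkv //= addrK.
  apply: (linked_cross (v := mkv (x + 1)%R y 1) (s := 2)) => //.
  - by rewrite lface_mkv //= addrK.
  - by exists B.
  - rewrite er => hst; apply: IH; last lia.
    by move=> g hg; apply: HB; apply: rt_trans hg; apply: rt_step.
case: f => [[x y] []] hf; have [B HB] := hf.
  by apply: (oct (absz (B%:Z - x)%R).+1 x y B) => //; lia.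
have er : rface (mkv x y 0) 0 = (x, y, true).
  by rewrite /rface nb_mkv lface_mkv.
apply: (linked_cross (v := mkv x y 0) (s := 0)) => //.
rewrite er => hst; apply: (oct (absz (B%:Z - x)%R).+1 x y B); last lia.
by move=> g hg; apply: HB; apply: rt_trans hg; apply: rt_step.
Qed.

Lemma system_connect i j : connect e i j.
Proof.
have toZ k : exists2 z, z \in Z & linked (pos k) z.
  have /posV[hk|[f hf hk]] : exists k', pos k' = pos k by exists k.
    by exists (pos k) => //; apply: linked_Z.
  by have [z hz H] := inner_to_Z hf; exists z => //; apply: H.
have [z hz h] := toZ i; have [z' hz' h'] := toZ j.
have [i' [j' [/pos_inj <- /pos_inj <- //]]] : linked (pos i) (pos j).
exact: linked_trans h (linked_trans (linked_Z hz hz') (linked_sym h')).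
Qed.

Lemma system_size : 2 < n.
Proof.
have [/andP[_ Zu] hZ] := Zcycle; apply: leq_trans hZ _.
apply: leq_trans (uniq_leq_size Zu (s2 := [seq pos i | i <- enum 'I_n]) _) _.
  move=> v hv; have /posV[i <-] : system_vertex Z v by left.
  by apply: map_f; rewrite mem_enum.
by rewrite size_map -cardE card_ord.
Qed.

Lemma system_cut_system : cut_system pos e.
Proof.
split; [exact: pos_inj|exact: system_net|exact: system_sym|exact: system_connect|
  exact: system_size|].
move=> i s hs /negP nf; apply: outer_ray => h; apply: nf; exact: inner_left_full.
Qed.

End SystemIsCutSystem.

Lemma C4C8_cut_system n (pos : 'I_n -> netv) (e : rel 'I_n) :
  C4C8_system pos e -> cut_system pos e.
Proof. by move=> [Z [h1 h2 h3 h4]]; apply: (system_cut_system h1 h2 h3 h4). Qed.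

(** * Distances *)

Section Distance.
Variables (n : nat) (e : rel 'I_n).
Hypothesis e_sym : symmetric e.
Hypothesis e_conn : forall i j, connect e i j.

Lemma walkP k u v :
  reflect (exists p, [/\ size p = k, path e u p & last u p = v]) (walk e k u v).
Proof.
apply: (iffP existsP) => [[p /andP[h1 /eqP h2]]|[p [h1 h2 h3]]].
  by exists p; rewrite size_tuple.
have hp : size p == k by apply/eqP.
by exists (Tuple hp); rewrite /= h2 h3 eqxx.
Qed.

Lemma walk0 u : walk e 0 u u.
Proof. by apply/walkP; exists [::]. Qed.

Lemma walk1 u v : e u v -> walk e 1 u v.
Proof. by move=> h; apply/walkP; exists [:: v]; rewrite /= h. Qed.

Lemma walk_cat k l v u w : walk e k u v -> walk e l v w -> walk e (k + l) u w.
Proof.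
move=> /walkP[p [<- hp lp]] /walkP[q [<- hq lq]]; apply/walkP; exists (p ++ q).
by rewrite size_cat cat_path last_cat lp hp hq lq.
Qed.

Lemma walk_sym k u v : walk e k u v -> walk e k v u.
Proof.
move=> /walkP[p [sp hp <-]] {v}; elim: p k u sp hp => [|w p IH] k u <- /=.
  by move=> _; apply: walk0.
move=> /andP[huw hp]; rewrite -addn1; apply: walk_cat (IH _ _ erefl hp) _.
by apply: walk1; rewrite e_sym.
Qed.

Lemma dist_le_walk k u v : walk e k u v -> dist e u v <= k.
Proof.
move=> h; rewrite /dist; have [kn|nk] := ltnP k n; last first.
  by apply: leq_trans (find_size _ _) _; rewrite size_iota.
rewrite leqNgt; apply/negP => /(before_find 0).
by rewrite nth_iota // add0n h.
Qed.

Lemma walk_dist u v : walk e (dist e u v) u v.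
Proof.
have /connectP[p0 hp0 ev] := e_conn u v.
case/shortenP: hp0 ev => p hp up _ ev.
have hw : walk e (size p) u v by apply/walkP; exists p.
have sp : size p < n.
  have := max_card [in u :: p]; rewrite card_ord; apply: leq_trans.
  by rewrite (card_uniqP up).
have hh : has (fun k => walk e k u v) (iota 0 n).
  by apply/hasP; exists (size p); rewrite ?mem_iota.
by have := nth_find 0 hh; rewrite nth_iota ?add0n // -[X in _ < X](size_iota 0 n) -has_find.
Qed.

Lemma dist_triangle v u w : dist e u w <= dist e u v + dist e v w.
Proof. by apply: dist_le_walk; apply: walk_cat (walk_dist _ _) (walk_dist _ _). Qed.

Lemma dist_sym u v : dist e u v = dist e v u.
Proof. by apply/eqP; rewrite eqn_leq !dist_le_walk // walk_sym // walk_dist. Qed.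

Lemma dist_refl u : dist e u u = 0.
Proof. by apply/eqP; rewrite -leqn0 dist_le_walk // walk0. Qed.

Lemma dist_eq0 u v : dist e u v = 0 -> u = v.
Proof. by move=> h; have := walk_dist u v; rewrite h => /walkP[p [/size0nil -> _]]. Qed.

Lemma dist_edge u v : e u v -> dist e u v <= 1.
Proof. by move=> h; apply: dist_le_walk; apply: walk1. Qed.

Lemma dist_step u v k : dist e u v = k.+1 -> exists2 w, e u w & dist e w v = k.
Proof.
move=> h; have := walk_dist u v; rewrite h => /walkP[[|w p] []] // [sp] /= /andP[huw hp] lp.
exists w => //; apply/eqP; rewrite eqn_leq; apply/andP; split.
  by apply: dist_le_walk; apply/walkP; exists p.
by have := dist_triangle w u v; rewrite h; have := dist_edge huw; lia.
Qed.

End Distance.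

(** * Cuts *)

Section Cuts.
Variables (n : nat) (pos : 'I_n -> netv) (e : rel 'I_n).
Hypothesis cs : cut_system pos e.

Local Notation dart := ('I_n * 'I_3)%type.
Local Notation ostep := (ostep pos e).
Local Notation left_full := (left_full pos e).
Local Notation dist := (dist e).

Let pos_inj := cs_inj cs.
Let e_sym := cs_sym cs.

Definition dhead (d : dart) : 'I_n := odflt d.1 (nbr pos e d.1 d.2).
Definition present (d : dart) : bool := nbr pos e d.1 d.2.
Definition rs3 (s : 'I_3) : 'I_3 := inord (rs s).
Definition drev (d : dart) : dart := (dhead d, rs3 d.2).

(** The next parallel dart on the cut line, across the face on the left; the cut ends where this
    face is incomplete. *)
Definition fwd (d : dart) : option dart :=
  if left_full d.1 d.2 then
    omap (fun j => (j, rs3 d.2)) (iter (face_half d.2) ostep (Some d.1, nat_of_ord d.2)).1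
  else None.

Definition ddir (d : dart) : nat := dir (pos d.1) d.2.
(** The position of a dart along its cut line. It strictly increases under [fwd]. *)
Definition rank (d : dart) : int := height (ddir d) (pos d.1).

Lemma val_rs3 s : rs3 s = rs s :> nat.
Proof. by rewrite /rs3 inordK // rs_lt3. Qed.

Lemma rs3K : involutive rs3.
Proof. by move=> s; apply: val_inj; rewrite /= !val_rs3 rsK. Qed.

Lemma presentP d : present d -> e d.1 (dhead d) /\ pos (dhead d) = net_nb d.2 (pos d.1).
Proof.
rewrite /present /dhead; case h : nbr => [j|] //= _.
by apply/nbrP.
Qed.

Lemma dheadP (d : dart) j : e d.1 j -> pos j = net_nb d.2 (pos d.1) -> present d /\ dhead d = j.
Proof.
move=> h1 h2; have /(nbrP e _ _ _ pos_inj) h : e d.1 j /\ pos j = net_nb d.2 (pos d.1) by [].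
by rewrite /present /dhead h.
Qed.

Lemma present_nbr d : present d -> nbr pos e d.1 d.2 = Some (dhead d).
Proof. by rewrite /present /dhead; case: nbr. Qed.

Lemma drev_present d : present d -> present (drev d) /\ dhead (drev d) = d.1.
Proof.
move=> /presentP[h1 h2]; apply: dheadP; rewrite /= ?val_rs3; first by rewrite e_sym.
by rewrite h2 nb_rs.
Qed.

Lemma drevK d : present d -> drev (drev d) = d.
Proof.
move=> h; rewrite /drev (proj2 (drev_present h)) /= rs3K; by case: d h.
Qed.

Lemma present_drev d : present d -> present (drev d).
Proof. by move=> /drev_present[]. Qed.

Lemma edge_dart i j : e i j -> exists d, [/\ present d, d.1 = i & dhead d = j].
Proof.
move=> h; have [s hs hp] := cs_net cs h.
have [h1 h2] := @dheadP (i, Ordinal hs) j h hp.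
by exists (i, Ordinal hs).
Qed.

Lemma dart_ext d d' : present d -> present d' -> d.1 = d'.1 -> dhead d = dhead d' -> d = d'.
Proof.
case: d d' => [i s] [i' s'] /presentP /= [_ h] /presentP /= [_ h'] e1 e2; subst i'.
congr (_, _); apply: val_inj; apply: (@nb_slot_inj s s' (pos i)) => //.
by rewrite -h -h' e2.
Qed.

Lemma ostep_slot k i s : (iter k ostep (Some i, s)).2 = (iter k nstep (pos i, s)).2.
Proof. by elim: k => //= k ->. Qed.

Lemma nstep_slot k d : d.2 < 3 -> (iter k nstep d).2 < 3.
Proof. by case: k => // k _; rewrite iterS nx_lt3. Qed.

Lemma ostep_pos k i s j : (iter k ostep (Some i, s)).1 = Some j ->
  pos j = (iter k nstep (pos i, s)).1.
Proof.
elim: k j => [|k IH] j /=; first by case=> ->.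
case h : (iter k ostep (Some i, s)).1 => [j'|] //= /(nbrP e _ _ _ pos_inj)[_ ->].
by rewrite (IH _ h) ostep_slot.
Qed.

Lemma ostep_none k s : (iter k ostep (None, s)).1 = None.
Proof. by elim: k s => // k IH s; rewrite iterSr IH. Qed.

Lemma full_iter k i s : s < 3 -> left_full i s ->
  exists2 j, iter k ostep (Some i, s) = (Some j, (iter k nstep (pos i, s)).2) &
             pos j = (iter k nstep (pos i, s)).1.
Proof.
move=> hs hf.
have h8 : iter 8 ostep (Some i, s) = (Some i, s).
  have := hf; rewrite /left_full; case h : (iter 8 ostep (Some i, s)) => [[j|] t] //= _.
  have hp := @ostep_pos 8 i s j; rewrite h nstep8 // in hp.
  have := ostep_slot 8 i s; rewrite h nstep8 //= => ->.
  by rewrite (pos_inj (hp erefl)).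
have h8k m : iter (m * 8) ostep (Some i, s) = (Some i, s).
  by elim: m => // m IH; rewrite mulSn iterD IH.
case h : (iter k ostep (Some i, s)).1 => [j|].
  exists j; last exact: ostep_pos.
  by rewrite -ostep_slot -h -surjective_pairing.
(* An undefined walk stays undefined, but after [k.+1 * 8] steps, more than [k], the walk is back at
   its start. *)
have := h8k k.+1; have -> : (k.+1 * 8 = (k * 7 + 8) + k)%N by lia.
rewrite iterD; move: h; case: (iter k _ _) => a t /= ->.
by move/(congr1 fst); rewrite ostep_none.
Qed.

Lemma full_dart k i s : s < 3 -> left_full i s ->
  exists d : dart, [/\ present d, iter k ostep (Some i, s) = (Some d.1, nat_of_ord d.2),
    iter k.+1 ostep (Some i, s) = (Some (dhead d), nx d.2) &
    (pos d.1, nat_of_ord d.2) = iter k nstep (pos i, s)].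
Proof.
move=> hs hf; have [j hj pj] := full_iter k hs hf.
have [j' hj' pj'] := full_iter k.+1 hs hf.
have ht := @nstep_slot k (pos i, s) hs.
pose d : dart := (j, Ordinal ht).
have hn : nbr pos e j (iter k nstep (pos i, s)).2 = Some j'.
  by move: hj'; rewrite iterS hj /ostep /= => -[].
have hd : present d by rewrite /present /= hn.
exists d; rewrite hj iterS hj /ostep /= hn /dhead /= hn; split=> //.
by rewrite pj -surjective_pairing.
Qed.

Lemma fwdP d d' : fwd d = Some d' ->
  [/\ left_full d.1 d.2, (iter (face_half d.2) ostep (Some d.1, nat_of_ord d.2)).1 = Some d'.1,
      d'.2 = rs3 d.2 & pos d'.1 = facing (pos d.1) d.2].
Proof.
rewrite /fwd; case hf: left_full => //; case h: (iter _ _ _).1 => [j|] //= [<-] /=.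
by split=> //; rewrite (ostep_pos h).
Qed.

Lemma fwd_none d : fwd d = None -> ~~ left_full d.1 d.2.
Proof.
rewrite /fwd; case: (boolP (left_full _ _)) => // hf.
by have [j -> _] := full_iter (face_half d.2) (ltn_ord d.2) hf.
Qed.

Lemma fwd_dart d d' k : fwd d = Some d' -> exists x : dart,
  [/\ present x, iter k ostep (Some d.1, nat_of_ord d.2) = (Some x.1, nat_of_ord x.2),
    iter k.+1 ostep (Some d.1, nat_of_ord d.2) = (Some (dhead x), nx x.2) &
    (pos x.1, nat_of_ord x.2) = iter k nstep (pos d.1, nat_of_ord d.2)].
Proof. by case/fwdP => hf _ _ _; apply: full_dart. Qed.

Lemma face_half_gt2 s : 2 < face_half s.
Proof. by rewrite /face_half; case: eqP. Qed.

Lemma fwd_present d d' : fwd d = Some d' ->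
  [/\ present d, present d' & iter (face_half d.2).-1 ostep (Some d.1, nat_of_ord d.2)
        = (Some (dhead d'), nat_of_ord d.2)].
Proof.
move=> h; have [hf hi hs hp] := fwdP h.
have [x [hx h0 h1 _]] := fwd_dart 0 h; have ex : x = d.
  by case: x d h0 {h hf hi hs hp h1 hx} => [? ?] [? ?] /= [-> /val_inj ->].
rewrite ex in hx; have [y [hy hy0 hy1 hyp]] := fwd_dart (face_half d.2).-1 h.
rewrite facing_head // in hyp; case: hyp => hyp1 hyp2.
have ey1 : dhead y = d'.1.
  by move: hy1; rewrite prednK ?(ltn_trans _ (face_half_gt2 _)) // => e1; move: hi; rewrite e1 /= => -[].
have ey : drev y = d'.
  by rewrite [d']surjective_pairing hs /drev ey1; congr (_, _); congr rs3; apply: val_inj.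
by rewrite -ey; have [h1' ->] := drev_present hy; split=> //; rewrite hy0 hyp2.
Qed.

Lemma fwd_drev d d' : fwd d = Some d' -> fwd (drev d') = Some (drev d).
Proof.
move=> h; have [hd hd' hi] := fwd_present h; have [hf _ hs hp] := fwdP h.
have er : (drev d').2 = d.2 by rewrite /= hs rs3K.
(* The tour from [dhead d'] is a later part of the tour from [d.1] around the same face, so
   completeness carries over. *)
have hf' : left_full (dhead d') d.2.
  rewrite /left_full -hi -iterD.
  by have [j -> _] := full_iter (8 + (face_half d.2).-1) (ltn_ord d.2) hf.
have [j hj pj] := full_iter (face_half d.2) (ltn_ord d.2) hf'.
rewrite /fwd er /= hf' hj /=; congr (Some (_, _)).
apply: pos_inj; rewrite pj -/(facing _ _).
have [_ ->] := presentP hd'; have [_ ->] := presentP hd.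
by rewrite hs val_rs3 hp facing_facing.
Qed.

Lemma ddir_drev d : present d -> ddir (drev d) = (ddir d + 4) %% 8.
Proof. by move=> /presentP[_ h]; rewrite /ddir /drev /= h val_rs3 dir_rs. Qed.

Lemma ddir_fwd d d' : fwd d = Some d' -> ddir d' = ddir d.
Proof. by move=> /fwdP[_ _ hs hp]; rewrite /ddir hs hp val_rs3 dir_facing. Qed.

Lemma rank_fwd d d' : fwd d = Some d' -> (rank d' = rank d + (face_half d.2 - 2)%N%:Z)%R.
Proof. by move=> h; rewrite /rank (ddir_fwd h); have [_ _ _ ->] := fwdP h; rewrite height_facing. Qed.

(* Here sg may change only across edges parallel to d, so it is constant on both
   shores of the cut. *)
Lemma fwd_ladder d d' : fwd d = Some d' ->
  [/\ walk e (face_half d.2 - 2) d.1 d'.1,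
      walk e (face_half d.2 - 2) (dhead d) (dhead d') &
      forall sg : 'I_n -> bool,
        (forall x, present x -> ddir x %% 4 != ddir d %% 4 -> sg x.1 = sg (dhead x)) ->
        sg d.1 = sg d'.1 /\ sg (dhead d) = sg (dhead d')].
Proof.
move=> h; have [hd hd' hi] := fwd_present h; have [hf hi' hs hp] := fwdP h.
set s := nat_of_ord d.2 in hi hi' hf *.
(* A stretch of [l] boundary steps that avoids the two parallel edges is a walk on which [sg] is
   constant. It is used for the shore of the heads, from step 1, and for the shore of the tails,
   from step [face_half s] back to the start. *)
have seg k l j : iter k ostep (Some d.1, s) = (Some j, (iter k nstep (pos d.1, s)).2) ->
    (forall m, k <= m < k + l -> (0 < m < (face_half s).*2 - 2) && (m != (face_half s).-1)) ->
  exists2 j', iter (k + l) ostep (Some d.1, s) = (Some j', (iter (k + l) nstep (pos d.1, s)).2) &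
    walk e l j j' /\ (forall sg : 'I_n -> bool,
        (forall x, present x -> ddir x %% 4 != ddir d %% 4 -> sg x.1 = sg (dhead x)) ->
        sg j = sg j').
  move=> hj; elim: l => [|l IH] hm.
    by exists j; rewrite ?addn0 //; split=> //; apply: walk0.
  have [j' hj' [hw hsg]] := IH (fun m hm' => hm m ltac:(lia)).
  have [x [hx h0 h1 hxp]] := full_dart (k + l) (ltn_ord d.2) hf.
  rewrite -/s in h0 h1 hxp.
  have ex : x.1 = j' by move: h0; rewrite hj' => -[].
  exists (dhead x); first by rewrite addnS h1 -ostep_slot h1.
  split=> [|sg Hsg].
    rewrite -addn1; apply: walk_cat hw _; apply: walk1; rewrite -ex.
    by case: (presentP hx).
  rewrite (hsg _ Hsg) -ex; apply: Hsg => //.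
  have /andP[m1 m2] := hm (k + l) ltac:(lia).
  by have := dir_ladder (pos d.1) (ltn_ord d.2) m1 m2; rewrite -/s -hxp.
have hg := face_half_gt2 s.
have h1 : iter 1 ostep (Some d.1, s) = (Some (dhead d), (iter 1 nstep (pos d.1, s)).2).
  by rewrite /= /ostep /= present_nbr.
have [j1 hj1 [w1 c1]] := seg 1 (face_half s - 2) (dhead d) h1 ltac:(by move=> m; lia).
have ej1 : j1 = dhead d'.
  move: hj1; have -> : 1 + (face_half s - 2) = (face_half s).-1 by lia.
  by rewrite hi => -[->].
have h2 : iter (face_half s) ostep (Some d.1, s) = (Some d'.1, (iter (face_half s) nstep (pos d.1, s)).2).
  by rewrite -ostep_slot -hi' -surjective_pairing.
have [j2 hj2 [w2 c2]] := seg (face_half s) (face_half s - 2) d'.1 h2 ltac:(by move=> m; lia).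
have ej2 : j2 = d.1.
  apply: pos_inj; have := @ostep_pos (face_half s + (face_half s - 2)) d.1 s j2.
  rewrite hj2 => /(_ erefl) ->.
  have -> : face_half s + (face_half s - 2) = (face_half s).*2 - 2 by lia.
  by rewrite (face_half_back _ (ltn_ord d.2)).
rewrite ej1 in w1 c1; rewrite ej2 in w2 c2; split=> //; first exact: walk_sym.
by move=> sg H; rewrite (c1 _ H) (c2 _ H).
Qed.

Definition cutrel : rel dart := fun d d' => fwd d == Some d'.

Lemma height_dist q u v : (`|height q (pos u) - height q (pos v)| <= (dist u v)%:Z)%R.
Proof.
have := walk_dist (cs_connect cs) u v; move: (dist u v) => k /walkP[p [<- hp <-]] {k v}.
elim: p u hp => [|w p IH] u /=; first by rewrite subrr.
move=> /andP[huw /IH h]; have [s hs hw] := cs_net cs huw.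
by have := height_lip q (pos u) hs; rewrite -hw; lia.
Qed.

Lemma connect_cutrel (d d' : dart) : connect cutrel d d' -> [/\ ddir d' = ddir d, (rank d <= rank d')%R,
  present d -> present d', walk e (absz (rank d' - rank d)%R) d.1 d'.1 &
  walk e (absz (rank d' - rank d)%R) (dhead d) (dhead d')].
Proof.
move=> /connectP[p hp ->] {d'}; elim: p d hp => [|x p IH] d /=.
  by move=> _; rewrite subrr; split=> //; apply: walk0.
move=> /andP[/eqP hx /IH[h1 h2 h3 h4 h5]].
have hr := rank_fwd hx; have [_ px _] := fwd_present hx; have hg := face_half_gt2 d.2.
have [w1 w2 _] := fwd_ladder hx.
have -> : absz (rank (last x p) - rank d)%R = (face_half d.2 - 2) + absz (rank (last x p) - rank x)%R.
  by lia.
split; [by rewrite h1 (ddir_fwd hx)|by apply: le_trans h2; rewrite hr lerDl|by move=> _; apply: h3| |].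
- exact: walk_cat w1 h4.
- exact: walk_cat w2 h5.
Qed.

Lemma rank_head d : present d -> height (ddir d) (pos (dhead d)) = rank d.
Proof. by move=> /presentP[_ h]; rewrite h height_head. Qed.

Lemma cutrel_dist (d d' : dart) : present d -> connect cutrel d d' ->
  dist d.1 d'.1 = dist (dhead d) (dhead d').
Proof.
move=> pd h; have [h1 h2 h3 h4 h5] := connect_cutrel h.
have := height_dist (ddir d) d.1 d'.1; have := height_dist (ddir d) (dhead d) (dhead d').
have r1 := rank_head pd; have r2 := rank_head (h3 pd); rewrite h1 in r2.
have r3 : height (ddir d) (pos d'.1) = rank d' by rewrite /rank h1.
rewrite r1 r2 r3 -/(rank d).
by have := dist_le_walk h4; have := dist_le_walk h5; lia.
Qed.

Lemma cutrel_total (D d d' : dart) : connect cutrel D d -> connect cutrel D d' ->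
  connect cutrel d d' \/ connect cutrel d' d.
Proof.
move=> /connectP[p hp ->] /connectP[q hq ->] {d d'}.
elim: p D hp q hq => [|x p IH] D /=; first by move=> _ q hq; left; apply/connectP; exists q.
move=> /andP[/eqP hx hp] [|y q] /=; last first.
  by move=> /andP[/eqP]; rewrite hx => -[<-]; apply: IH.
by move=> _; right; apply/connectP; exists (x :: p); rewrite //= /cutrel hx eqxx.
Qed.

Lemma cut_dist (D d d' : dart) : present D -> connect cutrel D d -> connect cutrel D d' ->
  dist d.1 d'.1 = dist (dhead d) (dhead d').
Proof.
move=> pD h h'; have [_ _ pd _ _] := connect_cutrel h; have [_ _ pd' _ _] := connect_cutrel h'.
case: (cutrel_total h h') => hc; first by apply: cutrel_dist; rewrite ?pd.
rewrite (dist_sym e_sym (cs_connect cs)) [RHS](dist_sym e_sym (cs_connect cs)).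
by apply: cutrel_dist; rewrite ?pd'.
Qed.

End Cuts.

(** * The two sides of a cut *)

Section Sides.
Variables (n : nat) (pos : 'I_n -> netv) (e : rel 'I_n).
Hypothesis cs : cut_system pos e.

Local Notation dart := ('I_n * 'I_3)%type.
Local Notation left_full := (left_full pos e).
Local Notation dist := (dist e).
Local Notation dhead := (dhead pos e).
Local Notation present := (present pos e).
Local Notation drev := (drev pos e).
Local Notation fwd := (fwd pos e).
Local Notation cutrel := (cutrel pos e).
Local Notation ddir := (ddir pos).
Local Notation rank := (rank pos).

Let pos_inj := cs_inj cs.
Let e_sym := cs_sym cs.
Let e_conn := cs_connect cs.

Lemma edge_ofE (d x : dart) : present d ->
  edge_of (pos d.1) d.2 (pos x.1) x.2 = (x == d) || (x == drev d).
Proof.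
move=> /(presentP cs)[_ h]; rewrite /edge_of -h !(inj_eq pos_inj) -(val_rs3 d.2).
by case: x => a b; case: d {h} => a' b'; rewrite /drev !xpair_eqE.
Qed.

Lemma telescope p (d : dart) : present d -> path cutrel d p -> fwd (last d p) = None ->
  coboundary pos e (fun v s => ray (rface (pos d.1) d.2) v s
     (+) \big[addb/false]_(x <- d :: p) edge_of (pos x.1) x.2 v s).
Proof.
have base (x : dart) : present x -> coboundary pos e (fun v s =>
    ray (lface (pos x.1) x.2) v s (+) ray (rface (pos x.1) x.2) v s
    (+) edge_of (pos x.1) x.2 v s).
  move=> hx; have [kap hk] := ray_cob (pos x.1) (ltn_ord x.2).
  by exists kap => i j s hs he ->; rewrite hk.
elim: p d => [|x p IH] d pd /=.
  move=> _ hn; have := coboundary_add (base d pd) (cs_ray cs (ltn_ord d.2) (fwd_none cs hn)).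
  apply: coboundary_ext => i j s _ _ _; rewrite big_seq1.
  by do 3 case: (_ (pos i) s).
move=> /andP[/eqP hx hp] hn; have [_ px _] := fwd_present cs hx.
have := coboundary_add (base d pd) (IH x px hp hn).
apply: coboundary_ext => i j s _ _ _; rewrite [in RHS]big_cons.
(* The ray of the face between [d] and [x] now occurs twice and cancels. *)
have -> : rface (pos x.1) x.2 = lface (pos d.1) d.2.
  by have [_ _ -> ->] := fwdP cs hx; rewrite val_rs3 rface_facing.
by case: (ray (lface _ _) _ _); case: (ray _ _ _); case: (edge_of _ _ _ _); case: (\big[_/_]_(_ <- _) _).
Qed.

Lemma path_cutrel_mem (d x : dart) p : path cutrel d p -> x \in d :: p -> connect cutrel d x.
Proof. by move=> hp hx; apply: (path_connect hp). Qed.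

Lemma path_cutrel_uniq p (d : dart) : path cutrel d p -> uniq (d :: p).
Proof.
elim: p d => [|x p IH] d //= /andP[/eqP hx hp]; have := IH x hp => /= ->; rewrite andbT.
apply/negP => hd; have [_ h _ _ _] := connect_cutrel cs (path_cutrel_mem hp hd).
by have := rank_fwd cs hx; have := face_half_gt2 d.2; lia.
Qed.

(** All darts of a chain have the same direction, while a reverse dart is turned by 180 degrees. *)
Lemma path_cutrel_norev p (d x : dart) : present d -> path cutrel d p -> x \in d :: p -> drev x \notin d :: p.
Proof.
move=> pd hp hx; apply/negP => hr.
have [h1 _ px _ _] := connect_cutrel cs (path_cutrel_mem hp hx).
have [h2 _ _ _ _] := connect_cutrel cs (path_cutrel_mem hp hr).
by move: h2; rewrite (ddir_drev cs) ?px // h1; have := dir_lt8 (pos d.1) d.2; rewrite -/(ddir d); lia.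
Qed.

(** At most one dart of [c] lies on the edge of [x], so the exclusive or is a disjunction. *)
Lemma big_edge (c : seq dart) (x : dart) : uniq c -> (forall y, y \in c -> present y) ->
  (forall y, y \in c -> drev y \notin c) -> present x ->
  \big[addb/false]_(y <- c) edge_of (pos y.1) y.2 (pos x.1) x.2 = (x \in c) || (drev x \in c).
Proof.
move=> + + + px; elim: c => [|y c IH] /=; first by rewrite big_nil.
move=> /andP[yc uc] pc nr; rewrite big_cons edge_ofE ?pc ?mem_head //.
rewrite IH // => [|z hz|z hz]; last 2 first.
- by apply: pc; rewrite inE hz orbT.
- by have := nr z; rewrite !inE hz orbT negb_or => /(_ isT)/andP[].
have -> : (x == drev y) = (drev x == y).
  apply/eqP/eqP => [->|<-]; rewrite (drevK cs) //; exact: pc (mem_head _ _).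
have := nr y (mem_head _ _); rewrite inE negb_or => /andP[_ ny].
have H : (x == y) || (drev x == y) -> (x \in c) || (drev x \in c) = false.
  case/orP => /eqP ey; first by rewrite ey (negPf yc) (negPf ny).
  by rewrite -{1}(drevK cs px) ey (negPf yc) (negPf ny).
rewrite !inE orbACA; move: H; case: (_ || (drev x == y)) => //= /(_ isT) ->.
by [].
Qed.

Lemma mod8_mod4 a b : a < 8 -> (b + 4) %% 8 = a -> b %% 4 = a %% 4.
Proof. lia. Qed.

Definition separates (c : seq dart) (sg : 'I_n -> bool) : Prop :=
  (forall x : dart, present x -> (sg x.1 != sg (dhead x)) = (x \in c) || (drev x \in c)) /\
  (forall x : dart, x \in c -> sg x.1 = false /\ sg (dhead x) = true).

(** The face on the right of [d] is the one on the left of its reverse; when it is incomplete, a cut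
    begins with [d]. *)
Definition start (d : dart) : bool := present d && ~~ left_full (drev d).1 (drev d).2.

Lemma chain_separates (D : dart) p : start D -> path cutrel D p -> fwd (last D p) = None ->
  exists sg, separates (D :: p) sg.
Proof.
move=> /andP[pD nf] hp hn.
have pres x : x \in D :: p -> present x.
  by move=> hx; have [_ _ px _ _] := connect_cutrel cs (path_cutrel_mem hp hx); apply: px.
have hr : coboundary pos e (ray (rface (pos D.1) D.2)).
  have := cs_ray cs (ltn_ord (drev D).2) nf; rewrite /= val_rs3.
  by have [_ ->] := presentP cs pD.
have [kap hk] := coboundary_add hr (telescope pD hp hn).
pose sg v := kap (pos v) (+) kap (pos D.1).
have sgE x : present x -> (sg x.1 != sg (dhead x)) = (x \in D :: p) || (drev x \in D :: p).
  move=> px; have [he hpos] := presentP cs px.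
  have := hk _ _ _ (ltn_ord x.2) he hpos; rewrite addbA addbb addFb big_edge //; first last.
  - by move=> y; apply: path_cutrel_norev.
  - exact: path_cutrel_uniq.
  by rewrite /sg => ->; do 3 case: (kap _).
exists sg; split=> // x hx.
have base : sg D.1 = false /\ sg (dhead D) = true.
  have := sgE _ pD; rewrite mem_head /sg addbb /=; by case: (_ (+) _).
(* [sg] changes only across the edges of the chain, which are all parallel to [y]; so [fwd_ladder]
   carries the two values from one edge of the chain to the next. *)
have ladder y z : y \in D :: p -> fwd y = Some z ->
    sg y.1 = false /\ sg (dhead y) = true -> sg z.1 = false /\ sg (dhead z) = true.
  move=> hy hz hsg; have [hy1 _ _ _ _] := connect_cutrel cs (path_cutrel_mem hp hy).
  have [_ _ /(_ sg)[]] := fwd_ladder cs hz; last by case: hsg => -> -> <- <-.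
  move=> w pw hd; apply/eqP; rewrite -[_ == _]negbK sgE //.
  apply/negP => hw; move/negP: hd; apply; rewrite hy1.
  case/orP: hw => hw; have [hw1 _ _ _ _] := connect_cutrel cs (path_cutrel_mem hp hw).
    by rewrite hw1.
  by apply/eqP/mod8_mod4; [apply: dir_lt8 | rewrite -(ddir_drev cs)].
have along q y : path cutrel y q -> {subset y :: q <= D :: p} ->
    sg y.1 = false /\ sg (dhead y) = true ->
    forall z, z \in y :: q -> sg z.1 = false /\ sg (dhead z) = true.
  elim: q y => [|w q IH] y /=; first by move=> _ _ h z; rewrite inE => /eqP ->.
  move=> /andP[/eqP hw hq] sub h z; rewrite inE => /orP[/eqP -> //|].
  apply: IH => // [v hv|]; first by apply: sub; rewrite inE hv orbT.
  by apply: ladder hw h; apply: sub; rewrite mem_head.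
exact: along hp _ base x hx.
Qed.

(** A shortest path from [w] to [v] has to use an edge of the cut; [b] tells whether it passes from
    tail to head or from head to tail. *)
Lemma separates_cross c sg b w v : separates c sg -> sg w = ~~ b -> sg v = b ->
  exists2 d : dart, d \in c & dist w (if b then d.1 else dhead d) + 1
     + dist (if b then dhead d else d.1) v <= dist w v.
Proof.
move=> [S1 S2]; move Ek: (dist w v) => k; elim: k w Ek => [|k IH] w Ek hw hv.
  by move: hw; rewrite (dist_eq0 e_conn Ek) hv; case: b {hv}.
have [w' hww' Ek'] := dist_step e_conn Ek.
have [hw'|hw'] := boolP (sg w' == ~~ b).
  have [d dc hd] := IH w' Ek' (eqP hw') hv; exists d => //.
  have := dist_triangle e_conn w' w (if b then d.1 else dhead d).
  by have := dist_edge hww'; lia.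
have {}hw' : sg w' = b by move: hw'; case: (sg w'); case: b {hw hv IH}.
have [x [px x1 xh]] := edge_dart cs hww'.
have := S1 x px; rewrite x1 xh hw hw'; have -> : ~~ b != b by case: b {hw hw' hv IH}.
move=> /esym/orP[] hx.
  exists x => //; have [] := S2 x hx; rewrite x1 xh hw hw'; case: b {hw hw' hv IH} => //= _ _.
  by rewrite dist_refl Ek'.
exists (drev x) => //; have [] := S2 _ hx; have [_ ->] := drev_present cs px.
rewrite /= x1 xh hw hw'; case: b {hw hw' hv IH} => //= _ _.
by rewrite dist_refl Ek'.
Qed.

(** Let a shortest path from the end of [d] on the other side to [v] cross the cut at [d']. By
    [cut_dist] the part before the crossing can be replaced by one of equal length on the shore of
    [v], which starts at the other end of [d] and saves the crossing. *)
Lemma separates_closer (D : dart) p sg (d : dart) v : present D -> path cutrel D p -> separates (D :: p) sg ->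
  d \in D :: p -> if sg v then dist (dhead d) v < dist d.1 v else dist d.1 v < dist (dhead d) v.
Proof.
move=> pD hp S hd; have [S1 S2] := S; have [t h] := S2 d hd.
have Dd := path_cutrel_mem hp hd.
case sv: (sg v).
  have [d' hd' le] := separates_cross (b := true) S t sv.
  have := cut_dist cs pD Dd (path_cutrel_mem hp hd').
  have := dist_triangle e_conn (dhead d') (dhead d) v; rewrite /= in le; lia.
have [d' hd' le] := separates_cross (b := false) S h sv.
have := cut_dist cs pD Dd (path_cutrel_mem hp hd').
have := dist_triangle e_conn d'.1 d.1 v; rewrite /= in le; lia.
Qed.

(** A path of [cutrel] repeats no dart, so it cannot outgrow the number of darts. *)
Lemma chain_exists (d : dart) : exists2 p, path cutrel d p & fwd (last d p) = None.
Proof.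
have H m : (exists2 p, path cutrel d p & fwd (last d p) = None) \/
           (exists2 p, path cutrel d p & size p = m).
  elim: m => [|m [h|[p hp sp]]]; [by right; exists [::]|by left|].
  case hl : (fwd (last d p)) => [x|]; last by left; exists p.
  right; exists (rcons p x); last by rewrite size_rcons sp.
  by rewrite rcons_path hp /cutrel hl eqxx.
have [//|[p hp sp]] := H #|{: dart}|.
have /card_uniqP h := path_cutrel_uniq hp.
by have := max_card [in d :: p]; rewrite h /= sp ltnn.
Qed.

Lemma chain_mem (D x : dart) p : path cutrel D p -> fwd (last D p) = None ->
  (x \in D :: p) = connect cutrel D x.
Proof.
move=> hp hn; apply/idP/idP => [|/connectP[q hq ->]]; first exact: path_cutrel_mem.
elim: p D hp hn q hq => [|y p IH] D /= hp hn [|z q] /=; rewrite ?mem_head //.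
  by rewrite /cutrel hn.
move=> /andP[hz hq]; case/andP: hp => hy hp.
have ez : z = y by move: hz hy; rewrite /cutrel => /eqP -> /eqP[].
by rewrite ez in hq *; rewrite inE IH ?orbT.
Qed.

Lemma connect_drev (a b : dart) : present a -> connect cutrel a b ->
  connect cutrel (drev b) (drev a).
Proof.
move=> pa /connectP[p hp ->]; elim: p a pa hp => [|x p IH] a pa /=; first by rewrite connect0.
move=> /andP[/eqP hx hp]; have [_ px _] := fwd_present cs hx.
apply: connect_trans (IH x px hp) _; apply: connect1.
by rewrite /cutrel (fwd_drev cs hx).
Qed.

Lemma connect_present (a b : dart) : present a -> connect cutrel a b -> present b.
Proof. by move=> pa /(connect_cutrel cs)[_ _ h _ _]; apply: h. Qed.

(** The reverse of the last dart of the chain of [drev d] is the first dart of the cut of [d]. *)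
Lemma start_exists (d : dart) : present d -> exists2 D : dart, start D & connect cutrel D d.
Proof.
move=> pd; have [p hp hn] := chain_exists (drev d).
have hl : connect cutrel (drev d) (last (drev d) p) by apply/connectP; exists p.
have pl := connect_present (present_drev cs pd) hl.
exists (drev (last (drev d) p)); last first.
  by rewrite -{2}(drevK cs pd); apply: connect_drev => //; apply: present_drev.
by rewrite /start (present_drev cs pl) (drevK cs pl) (fwd_none cs hn).
Qed.

(** Both reversed starts are reached from [drev d], so one is reached from the other; but neither
    has a successor. *)
Lemma start_unique (D D' d : dart) : start D -> start D' -> connect cutrel D d ->
  connect cutrel D' d -> D = D'.
Proof.
move=> /andP[pD sD] /andP[pD' sD'] h h'.
have fN (x : dart) : ~~ left_full x.1 x.2 -> fwd x = None by rewrite /fwd => /negPf ->.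
have stuck (x y : dart) : fwd x = None -> connect cutrel x y -> x = y.
  move=> hx /connectP[[|z q] //= /andP[]]; by rewrite /cutrel hx.
have : drev D = drev D'.
  case: (cutrel_total (connect_drev pD h) (connect_drev pD' h')) => hc.
    exact: stuck (fN _ sD) hc.
  by rewrite (stuck _ _ (fN _ sD') hc).
by move=> eD; rewrite -(drevK cs pD) eD (drevK cs pD').
Qed.

(** Sides are defined by distances, for every dart and without a choice of potential; [headside_cut]
    shows that the darts of one cut give the same sides. *)
Definition headside (d : dart) (v : 'I_n) : bool := dist (dhead d) v < dist d.1 v.

Lemma headside_cut (D d : dart) v : start D -> connect cutrel D d ->
  headside d v = headside D v /\ dist d.1 v != dist (dhead d) v.
Proof.
move=> sD hd; have [p hp hn] := chain_exists D; have [sg S] := chain_separates sD hp hn.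
have pD : present D by case/andP: sD.
have := separates_closer v pD hp S (mem_head _ _); rewrite -(chain_mem _ hp hn) in hd.
have := separates_closer v pD hp S hd; rewrite /headside; case: (sg v); lia.
Qed.

Lemma headside_drev (d : dart) v : present d -> headside (drev d) v = ~~ headside d v.
Proof.
move=> pd; have [D sD hD] := start_exists pd; have [_ h] := headside_cut v sD hD.
by rewrite /headside (proj2 (drev_present cs pd)) /=; lia.
Qed.

Lemma headside_tail (d : dart) : present d -> headside d d.1 = false /\ headside d (dhead d) = true.
Proof.
move=> pd; rewrite /headside !dist_refl; split=> //.
have [D sD hD] := start_exists pd; have [_] := headside_cut d.1 sD hD.
by rewrite dist_refl (dist_sym e_sym e_conn); lia.
Qed.

Lemma headside_cross (D x : dart) : start D -> present x ->
  (headside D x.1 != headside D (dhead x)) = connect cutrel D x || connect cutrel D (drev x).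
Proof.
move=> sD px; have [p hp hn] := chain_exists D; have [sg S] := chain_separates sD hp hn.
have pD : present D by case/andP: sD.
have hs v : headside D v = sg v.
  have := separates_closer v pD hp S (mem_head _ _); rewrite /headside; case: (sg v); lia.
by rewrite !hs (proj1 S) // !(chain_mem _ hp hn).
Qed.

End Sides.

(** * Indices as sums over cuts *)

(** On the right, a pair separated by [b] is counted once, in the order that begins on the side
    where [b] fails. *)
Lemma half_sum n (b : 'I_n -> bool) (F : 'I_n -> 'I_n -> nat) :
  (forall u v, F u v = F v u) ->
  \sum_(u < n) \sum_(v < n | u < v) (b u != b v) * F u v
  = \sum_(u < n) \sum_(v < n) (~~ b u && b v) * F u v.
Proof.
move=> Fsym.
transitivity (\sum_(u < n) \sum_(v < n | u < v) (~~ b u && b v) * F u v +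
              \sum_(u < n) \sum_(v < n | u < v) (~~ b v && b u) * F u v).
  rewrite -big_split; apply: eq_bigr => u _; rewrite -big_split; apply: eq_bigr => v _ /=.
  by rewrite -mulnDl; case: (b u); case: (b v).
have -> : \sum_(u < n) \sum_(v < n | u < v) (~~ b v && b u) * F u v =
          \sum_(u < n) \sum_(v < n | v < u) (~~ b u && b v) * F u v.
  rewrite (exchange_big_dep predT) //=; apply: eq_bigr => u _.
  by apply: eq_bigr => v _; rewrite Fsym.
rewrite -big_split; apply: eq_bigr => u _ /=.
rewrite [RHS](bigID (fun v : 'I_n => u < v)) /=; congr (_ + _).
rewrite [RHS](bigID (fun v : 'I_n => v < u)) /= [X in _ = _ + X]big1.
  by rewrite addn0; apply: eq_bigl => v; lia.
move=> v hv; have -> : v = u by apply: val_inj => /=; lia.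
by case: (b u).
Qed.

Section CutSums.
Variables (n : nat) (pos : 'I_n -> netv) (e : rel 'I_n) (r : 'I_n).
Hypothesis cs : cut_system pos e.

Local Notation dart := ('I_n * 'I_3)%type.
Local Notation dist := (dist e).
Local Notation dhead := (dhead pos e).
Local Notation present := (present pos e).
Local Notation drev := (drev pos e).
Local Notation fwd := (fwd pos e).
Local Notation cutrel := (cutrel pos e).
Local Notation start := (start pos e).
Local Notation headside := (headside pos e).

Let e_sym := cs_sym cs.
Let e_conn := cs_connect cs.

(* Each cut has two orientations; the one leading away from r represents it. *)
Definition rooted (D : dart) : bool := start D && ~~ headside D r.
Definition cutsize (D : dart) : nat := #|[set v | headside D v]|.

(** The chains through [x] and through its reverse have complementary head sides; the rooted one is
    that whose head side misses [r]. *)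
Lemma rooted_cut (x : dart) : present x -> exists D : dart,
  [/\ rooted D, connect cutrel D x || connect cutrel D (drev x) &
    forall D', rooted D' -> connect cutrel D' x || connect cutrel D' (drev x) -> D' = D].
Proof.
move=> px; have prx := present_drev cs px.
have [D1 s1 c1] := start_exists cs px; have [D2 s2 c2] := start_exists cs prx.
have h1 := proj1 (headside_cut cs r s1 c1); have h2 := proj1 (headside_cut cs r s2 c2).
rewrite (headside_drev cs _ px) in h2.
have uniqD D' : rooted D' -> connect cutrel D' x || connect cutrel D' (drev x) ->
    D' = if headside x r then D2 else D1.
  move=> /andP[s' r'] /orP[c'|c']; have := proj1 (headside_cut cs r s' c').
    rewrite (negPf r') => hx; have -> : headside x r = false by exact: hx.
    exact: (start_unique cs s' s1 c' c1).
  rewrite (negPf r') (headside_drev cs _ px) => /negbFE hx.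
  have -> : headside x r = true by exact: hx.
  exact: (start_unique cs s' s2 c' c2).
exists (if headside x r then D2 else D1); split=> //; rewrite /rooted.
  by case: (headside x r) h1 h2 => h1 h2; rewrite ?s1 ?s2 -?h1 -?h2.
by case: ifP; rewrite ?c1 ?c2 ?orbT.
Qed.

(** Induction along a shortest path: its first edge changes sides in exactly one rooted cut, and [v]
    lies beyond that cut because the step brings it closer. *)
Lemma dist_cuts u v :
  dist u v = \sum_(D | rooted D) (headside D u != headside D v).
Proof.
move Ek: (dist u v) => k; elim: k u Ek => [|k IH] u Ek.
  by rewrite big1 // => D _; rewrite (dist_eq0 e_conn Ek) eqxx.
have [w huw Ew] := dist_step e_conn Ek.
have [x [px x1 xh]] := edge_dart cs huw; have [D [rD cD uD]] := rooted_cut px.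
have sD : start D by case/andP: rD.
rewrite (bigD1 D) //= -add1n (IH w Ew) [in LHS](bigD1 D) //= addnA; congr (_ + _).
  have hx : headside x v by rewrite /headside x1 xh Ek Ew.
  have [t h] := headside_tail cs px; rewrite x1 in t; rewrite xh in h.
  case/orP: cD => cD.
    have H z := proj1 (headside_cut cs z sD cD).
    by rewrite -!H hx t h.
  have H z := proj1 (headside_cut cs z sD cD).
  by rewrite -!H !(headside_drev cs _ px) hx t h.
apply: eq_bigr => D' /andP[rD' nD]; have [sD' _] := andP rD'.
suff -> : headside D' w = headside D' u by [].
have [//|] := eqVneq (headside D' u) (headside D' w).
rewrite -x1 -xh (headside_cross cs) // => h.
by move/eqP: nD; case; apply: uD.
Qed.

Lemma sum_headside D :
  \sum_(u < n) \sum_(v < n) (~~ headside D u && headside D v) = cutsize D * (n - cutsize D).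
Proof.
have -> : n - cutsize D = \sum_(u < n) (~~ headside D u).
  have := cardsC [set v | headside D v]; rewrite card_ord => hc.
  have -> : n - cutsize D = #|~: [set v | headside D v]| by rewrite /cutsize; lia.
  by rewrite -sum1_card big_mkcond; apply: eq_bigr => v _; rewrite !inE; case: headside.
have -> : cutsize D = \sum_(u < n) (headside D u).
  by rewrite /cutsize -sum1_card big_mkcond; apply: eq_bigr => v _; rewrite !inE; case: headside.
rewrite mulnC big_distrl; apply: eq_bigr => u _; rewrite big_distrr; apply: eq_bigr => v _ /=.
by case: headside; case: headside.
Qed.

Lemma wiener_cuts : wiener e = \sum_(D | rooted D) cutsize D * (n - cutsize D).
Proof.
transitivity (\sum_(u < n) \sum_(v < n | u < v) \sum_(D | rooted D) (headside D u != headside D v)).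
  by apply: eq_bigr => u _; apply: eq_bigr => v _; apply: dist_cuts.
transitivity (\sum_(D | rooted D) \sum_(u < n) \sum_(v < n | u < v) (headside D u != headside D v)).
  rewrite [RHS]exchange_big; apply: eq_bigr => u _; exact: exchange_big.
apply: eq_bigr => D _; rewrite -sum_headside.
have := @half_sum n (headside D) (fun _ _ => 1) (fun _ _ => erefl).
by under eq_bigr do under eq_bigr do rewrite muln1; move=> ->;
  apply: eq_bigr => u _; apply: eq_bigr => v _; rewrite muln1.
Qed.

Lemma closer_cut (D x : dart) : present x -> start D ->
  connect cutrel D x || connect cutrel D (drev x) ->
  closer e x.1 (dhead x) * closer e (dhead x) x.1 = cutsize D * (n - cutsize D).
Proof.
move=> px sD.
have cl (y : dart) : present y -> connect cutrel D y ->
    closer e (dhead y) y.1 = cutsize D /\ closer e y.1 (dhead y) = n - cutsize D.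
  move=> py cy; have H z := headside_cut cs z sD cy.
  have c1 : closer e (dhead y) y.1 = cutsize D.
    rewrite /closer /cutsize; apply: eq_card => w; rewrite !inE -(proj1 (H w)) /headside.
    by rewrite !(dist_sym e_sym e_conn w).
  split=> //; rewrite -c1 /closer.
  have := cardsC [set w | dist w (dhead y) < dist w y.1]; rewrite card_ord => hc.
  rewrite -[n in n - _]hc addKn; apply: eq_card => w; rewrite !inE.
  by have [_] := H w; rewrite !(dist_sym e_sym e_conn w); lia.
case/orP => [/(cl _ px)[-> ->]|/(cl _ (present_drev cs px))]; first by rewrite mulnC.
by rewrite (proj2 (drev_present cs px)) => -[-> ->].
Qed.

(** An edge from the tail side to the head side lies on the chain of [D] or its reverse does; in the
    latter case it would lead from the head side to the tail side. *)
Lemma sum_chain (D : dart) (F : 'I_n -> 'I_n -> nat) : start D ->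
  \sum_(u < n) \sum_(v < n) (~~ headside D u && headside D v) * e u v * F u v
  = \sum_(x : dart | connect cutrel D x) F x.1 (dhead x).
Proof.
move=> sD.
transitivity (\sum_(p : 'I_n * 'I_n | [&& ~~ headside D p.1, headside D p.2 & e p.1 p.2]) F p.1 p.2).
  rewrite pair_bigA [RHS]big_mkcond; apply: eq_bigr => -[u v] _ /=.
  by case: headside; case: headside; case: (e u v); rewrite ?mul1n.
have pD : present D by case/andP: sD.
rewrite (reindex_onto (fun x : dart => (x.1, dhead x))
  (fun p => odflt (p.1, ord0) [pick x : dart | present x && ((x.1, dhead x) == p)])) /=; last first.
  move=> [u v] /and3P[_ _ /= he]; case: pickP => [x /andP[_ /eqP]//|H].
  have [x [px x1 xh]] := edge_dart cs he.
  by have := H x; rewrite px x1 xh eqxx.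
apply: eq_bigl => x; apply/idP/idP.
  move=> /andP[/and3P[h1 h2 h3]]; case: pickP => [y /andP[py /eqP[y1 yh]] /= /eqP ex|H]; last first.
    have [y [py y1 yh]] := edge_dart cs h3.
    by have := H y; rewrite py y1 yh eqxx.
  have px : present x by rewrite -ex.
  have : headside D x.1 != headside D (dhead x) by rewrite (negPf h1) h2.
  rewrite (headside_cross cs) // => /orP[//|hr].
  have := proj1 (headside_cut cs x.1 sD hr).
  by rewrite (headside_drev cs _ px) (proj1 (headside_tail cs px)) (negPf h1).
move=> hx; have px := connect_present cs pD hx.
have [t h] := headside_tail cs px.
rewrite -(proj1 (headside_cut cs x.1 sD hx)) -(proj1 (headside_cut cs (dhead x) sD hx)) t h /=.
rewrite (proj1 (presentP cs px)) /=.
case: pickP => [y /andP[py /eqP[y1 yh]] /=|H]; last by have := H x; rewrite px eqxx.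
by apply/eqP; apply: (dart_ext cs).
Qed.

Lemma card_chain (D : dart) : start D ->
  \sum_(u < n) \sum_(v < n) (~~ headside D u && headside D v) * e u v
  = #|[set x : dart | connect cutrel D x]|.
Proof.
move=> sD; rewrite cardsE -sum1_card -(sum_chain (fun _ _ => 1) sD).
by apply: eq_bigr => u _; apply: eq_bigr => v _; rewrite muln1.
Qed.

Lemma szeged_cuts : szeged e = \sum_(D | rooted D)
  #|[set x : dart | connect cutrel D x]| * (cutsize D * (n - cutsize D)).
Proof.
transitivity (\sum_(u < n) \sum_(v < n | u < v) \sum_(D | rooted D)
   (headside D u != headside D v) * e u v * (cutsize D * (n - cutsize D))).
  apply: eq_bigr => u _; rewrite big_mkcondr; apply: eq_bigr => v _.
  case: ifP => he; last by rewrite big1 // => D _; rewrite muln0.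
  have [x [px x1 xh]] := edge_dart cs he; have [D [rD cD uD]] := rooted_cut px.
  have sD : start D by case/andP: rD.
  rewrite (bigD1 D) //= big1 => [|D' /andP[rD' nD]].
    by rewrite -x1 -xh (headside_cross cs) // cD !mul1n addn0 (closer_cut px sD cD).
  rewrite -x1 -xh (headside_cross cs) //; last by case/andP: rD'.
  suff /negPf -> : ~~ (connect cutrel D' x || connect cutrel D' (drev x)) by [].
  by apply: contra nD => h; apply/eqP; apply: uD.
transitivity (\sum_(D | rooted D) \sum_(u < n) \sum_(v < n | u < v)
   (headside D u != headside D v) * e u v * (cutsize D * (n - cutsize D))).
  rewrite [RHS]exchange_big; apply: eq_bigr => u _; exact: exchange_big.
apply: eq_bigr => D /andP[sD _]; rewrite -card_chain //.
rewrite -half_sum; last by move=> u v; rewrite e_sym.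
by rewrite big_distrl; apply: eq_bigr => u _; rewrite big_distrl.
Qed.

(** * The flow of subtree sizes in a spanning tree *)

Section Flow.
Variables (par : 'I_n -> option 'I_n) (sz : 'I_n -> nat).
Hypothesis par_root : forall v, (par v == None) = (v == r).
Hypothesis par_edge : forall u v, par v = Some u -> e u v.
Hypothesis sz_flow : forall v, sz v = (\sum_(c | par c == Some v) sz c).+1.

(* Each vertex v receives sz v units from its parent and keeps one of them, so
   the net flow across a cut counts the vertices behind it. *)
Lemma flow_across (b : 'I_n -> bool) :
  b r * sz r + \sum_(u < n) \sum_(v < n) (~~ b u && b v) * ((par v == Some u) * sz v)
  = \sum_(v < n) b v + \sum_(u < n) \sum_(v < n) (~~ b v && b u) * ((par v == Some u) * sz v).
Proof.
(* The flow along tree edges with both ends in [b]; it occurs on both sides and cancels. *)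
pose X := \sum_(u < n) \sum_(v < n) (b v && b u) * ((par v == Some u) * sz v).
have h1 : \sum_(v < n) b v * sz v = \sum_(v < n) b v +
    \sum_(u < n) \sum_(v < n) b u * ((par v == Some u) * sz v).
  rewrite -big_split; apply: eq_bigr => v _ /=; rewrite -big_distrr /= {1}sz_flow -add1n mulnDr muln1.
  congr (_ + _ * _); rewrite big_mkcond; apply: eq_bigr => c _; by case: ifP; rewrite ?mul1n.
have h2 : \sum_(v < n) b v * sz v = b r * sz r +
    \sum_(u < n) \sum_(v < n) b v * ((par v == Some u) * sz v).
  rewrite [in RHS]exchange_big (bigD1 r) //= [in RHS](bigD1 r) //= [X in _ = _ + (X + _)]big1 => [|u _].
    congr (_ + _); apply: eq_bigr => v vr.
    have := par_root v; rewrite (negPf vr); case hp: (par v) => [u|] // _.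
    rewrite (bigD1 u) //= eqxx mul1n big1 ?addn0 // => u' hu'.
    by rewrite (inj_eq Some_inj) eq_sym (negPf hu') muln0.
  by have := par_root r; rewrite eqxx => /eqP ->; rewrite muln0.
have e1 : \sum_(u < n) \sum_(v < n) b u * ((par v == Some u) * sz v) = X +
     \sum_(u < n) \sum_(v < n) (~~ b v && b u) * ((par v == Some u) * sz v).
  rewrite -big_split; apply: eq_bigr => u _; rewrite -big_split; apply: eq_bigr => v _ /=.
  by rewrite -mulnDl; case: (b u); case: (b v).
have e2 : \sum_(u < n) \sum_(v < n) b v * ((par v == Some u) * sz v) = X +
     \sum_(u < n) \sum_(v < n) (~~ b u && b v) * ((par v == Some u) * sz v).
  rewrite -big_split; apply: eq_bigr => u _; rewrite -big_split; apply: eq_bigr => v _ /=.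
  by rewrite -mulnDl; case: (b u); case: (b v).
move: h1 h2; rewrite e1 e2; lia.
Qed.

Lemma flow_root : sz r = n.
Proof.
have := flow_across (fun=> true); rewrite sum_nat_const card_ord muln1 mul1n.
have -> : \sum_(u < n) \sum_(v < n) (~~ true && true) * ((par v == Some u) * sz v) = 0.
  by rewrite big1 // => u _; rewrite big1.
lia.
Qed.

Lemma flow_cut (D : dart) : start D ->
  \sum_(x : dart | connect cutrel D x) (par (dhead x) == Some x.1) * sz (dhead x)
  - \sum_(x : dart | connect cutrel D x) (par x.1 == Some (dhead x)) * sz x.1
  = if headside D r then 0 else cutsize D.
Proof.
move=> sD; have := flow_across (headside D); rewrite flow_root.
have -> : \sum_(v < n) headside D v = cutsize D.
  by rewrite /cutsize -sum1_card [RHS]big_mkcond; apply: eq_bigr => v _; rewrite !inE; case: headside.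
rewrite -(sum_chain (fun u v => (par v == Some u) * sz v) sD).
rewrite -(sum_chain (fun u v => (par u == Some v) * sz u) sD).
rewrite (_ : \sum_(u < n) \sum_(v < n) (~~ headside D u && headside D v) * e u v
   * ((par v == Some u) * sz v) = \sum_(u < n) \sum_(v < n) (~~ headside D u && headside D v)
   * ((par v == Some u) * sz v)); last first.
  apply: eq_bigr => u _; apply: eq_bigr => v _.
  by case: eqP => [/par_edge ->|]; rewrite ?muln1 ?muln0.
rewrite [X in _ -> _ - X = _](_ : _ = \sum_(u < n) \sum_(v < n) (~~ headside D v && headside D u)
   * ((par v == Some u) * sz v)); last first.
  rewrite exchange_big; apply: eq_bigr => u _; apply: eq_bigr => v _ /=.
  by case: eqP => [/par_edge he|]; rewrite ?muln0 // e_sym he muln1.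
have hc : cutsize D <= n by rewrite -[n in _ <= n]card_ord max_card.
(* With the root on the head side the identity reads n + inflow = cutsize + outflow, so cutsize <= n
   makes the truncated difference 0. *)
case: headside => /=; lia.
Qed.

End Flow.

End CutSums.

(** * Straight-line programs *)

Fixpoint ev (s : state) (x : expr) : nat :=
  match x with
  | EConst k => k
  | EReg r => regs s r
  | ELoad a => ram s (ev s a)
  | EAdd a b => ev s a + ev s b
  | ESub a b => ev s a - ev s b
  | EMul a b => ev s a * ev s b
  end.

(* If all words of a state are at most M, every value met during the evaluation
   of x is at most M ^ deg x, provided M bounds the constants of x. *)
Fixpoint deg (x : expr) : nat :=
  match x with
  | EConst _ | EReg _ => 1
  | ELoad a => maxn 1 (deg a)
  | EAdd a b => (maxn (deg a) (deg b)).+1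
  | ESub a b => maxn (deg a) (deg b)
  | EMul a b => deg a + deg b
  end.

Fixpoint consts_le (k : nat) (x : expr) : bool :=
  match x with
  | EConst c => c <= k
  | EReg _ => true
  | ELoad a => consts_le k a
  | EAdd a b | ESub a b | EMul a b => consts_le k a && consts_le k b
  end.

(** The largest constant of the program is 9, the factor of n in the addresses of the queue. *)
Definition fits (K : nat) (x : expr) : bool := (deg x <= K) && consts_le 9 x.

(** [run], [run_cost] and [writes_le] describe loop-free code; loops are treated by [wp_while],
    [wp_loop] and [wp_exit]. *)
Fixpoint fits_com (K : nat) (c : com) : bool :=
  match c with
  | CSkip => true
  | CSet _ x => fits K x
  | CStore a x => fits K a && fits K x
  | CSeq c1 c2 => fits_com K c1 && fits_com K c2
  | CIf x c1 c2 => [&& fits K x, fits_com K c1 & fits_com K c2]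
  | CWhile _ _ => false
  end.

Fixpoint run (c : com) (s : state) : state :=
  match c with
  | CSkip => s
  | CSet r x => set_reg s r (ev s x)
  | CStore a x => set_ram s (ev s a) (ev s x)
  | CSeq c1 c2 => run c2 (run c1 s)
  | CIf x c1 c2 => if ev s x != 0 then run c1 s else run c2 s
  | CWhile _ _ => s
  end.

Fixpoint run_cost (c : com) : nat :=
  match c with
  | CSkip => 1
  | CSet _ x => (cost x).+1
  | CStore a x => (cost a + cost x).+1
  | CSeq c1 c2 => run_cost c1 + run_cost c2
  | CIf x c1 c2 => (cost x).+1 + maxn (run_cost c1) (run_cost c2)
  | CWhile _ _ => 0
  end.

Section Machine.
Variables (M K : nat).
Hypothesis M9 : 9 <= M.

(** Stored values have to stay at most [M], while intermediate values of an expression may reach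
    [M ^ K], the word bound of the machine. *)
Fixpoint writes_le (c : com) (s : state) : Prop :=
  match c with
  | CSkip | CWhile _ _ => True
  | CSet _ x | CStore _ x => ev s x <= M
  | CSeq c1 c2 => writes_le c1 s /\ writes_le c2 (run c1 s)
  | CIf x c1 c2 => if ev s x != 0 then writes_le c1 s else writes_le c2 s
  end.

Definition bounded (s : state) : Prop :=
  (forall r, regs s r <= M) /\ (forall a, ram s a <= M).

Lemma bounded_reg s r v : bounded s -> v <= M -> bounded (set_reg s r v).
Proof.
by move=> [h1 h2] hv; split=> // r' /=; rewrite /upd; case: eqP.
Qed.

Lemma bounded_ram s a v : bounded s -> v <= M -> bounded (set_ram s a v).
Proof.
by move=> [h1 h2] hv; split=> // r' /=; rewrite /upd; case: eqP.
Qed.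

Lemma eval_ev B s x : bounded s -> consts_le 9 x -> M ^ deg x <= B ->
  eval B s x = Some (ev s x) /\ ev s x <= M ^ deg x.
Proof.
move=> [hr hm] + hB.
have M0 : 0 < M by apply: leq_trans M9.
have mono m k : m <= k -> M ^ m <= M ^ k by move=> h; rewrite leq_pexp2l.
have w v m : v <= M ^ m -> M ^ m <= B -> word B v = Some v.
  by move=> h1 h2; rewrite /word (leq_trans h1 h2).
elim: x hB => [k|r|a IHa|a IHa b IHb|a IHa b IHb|a IHa b IHb] /= hB hc.
- have h : k <= M ^ 1 by rewrite expn1 (leq_trans hc M9).
  by rewrite (w _ _ h hB).
- have h : regs s r <= M ^ 1 by rewrite expn1.
  by rewrite (w _ _ h hB).
- have h : ram s (ev s a) <= M ^ 1 by rewrite expn1.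
  have [-> _] := IHa (leq_trans (mono _ _ (leq_maxr _ _)) hB) hc.
  split; last by apply: leq_trans h (mono _ _ (leq_maxl _ _)).
  by rewrite /= (w _ _ h) // (leq_trans (mono _ _ (leq_maxl _ _)) hB).
- case/andP: hc => ca cb.
  have ma : M ^ deg a <= M ^ (maxn (deg a) (deg b)) by rewrite mono ?leq_maxl.
  have mb : M ^ deg b <= M ^ (maxn (deg a) (deg b)) by rewrite mono ?leq_maxr.
  have mx : M ^ maxn (deg a) (deg b) <= M ^ (maxn (deg a) (deg b)).+1 by rewrite mono.
  have [-> ha] := IHa (leq_trans ma (leq_trans mx hB)) ca.
  have [-> hb] := IHb (leq_trans mb (leq_trans mx hB)) cb.
  have h : ev s a + ev s b <= M ^ (maxn (deg a) (deg b)).+1.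
    apply: leq_trans (leq_add (leq_trans ha ma) (leq_trans hb mb)) _.
    by rewrite addnn -mul2n expnS leq_mul2r (leq_trans _ M9) ?orbT.
  by rewrite /op2 /= (w _ _ h hB).
- case/andP: hc => ca cb.
  have ma : M ^ deg a <= M ^ (maxn (deg a) (deg b)) by rewrite mono ?leq_maxl.
  have mb : M ^ deg b <= M ^ (maxn (deg a) (deg b)) by rewrite mono ?leq_maxr.
  have [-> ha] := IHa (leq_trans ma hB) ca.
  have [-> hb] := IHb (leq_trans mb hB) cb.
  have h : ev s a - ev s b <= M ^ (maxn (deg a) (deg b)).
    exact: leq_trans (leq_subr _ _) (leq_trans ha ma).
  by rewrite /op2 /= (w _ _ h hB).
- case/andP: hc => ca cb.
  have ma : M ^ deg a <= M ^ (deg a + deg b) by rewrite mono ?leq_addr.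
  have mb : M ^ deg b <= M ^ (deg a + deg b) by rewrite mono ?leq_addl.
  have [-> ha] := IHa (leq_trans ma hB) ca.
  have [-> hb] := IHb (leq_trans mb hB) cb.
  have h : ev s a * ev s b <= M ^ (deg a + deg b) by rewrite expnD leq_mul.
  by rewrite /op2 /= (w _ _ h hB).
Qed.

Lemma eval_fits s x : bounded s -> fits K x -> eval (M ^ K) s x = Some (ev s x).
Proof.
move=> hb /andP[hd hc].
have [] // := eval_ev (B := M ^ K) hb hc.
by rewrite leq_pexp2l // (leq_trans _ M9).
Qed.

Definition wp (c : com) (t : nat) (s : state) (Q : state -> Prop) : Prop :=
  exists t' s', [/\ exec (M ^ K) c s t' s', t' <= t & Q s'].

Lemma wp_run c s (Q : state -> Prop) t : bounded s -> fits_com K c -> writes_le c s ->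
  run_cost c <= t -> (bounded (run c s) -> Q (run c s)) -> wp c t s Q.
Proof.
move=> hb hf hw ht hQ.
suff [hb' [t' he ht']] : bounded (run c s) /\ exists2 t', exec (M ^ K) c s t' (run c s) & t' <= run_cost c.
  by exists t', (run c s); split=> //; [apply: leq_trans ht|apply: hQ].
elim: c s hb hf hw {Q t ht hQ} => [|r x|a x|c1 IH1 c2 IH2|x c1 IH1 c2 IH2|x c _] s hb /=.
- by move=> _ _; split=> //; exists 1 => //; constructor.
- move=> hf hw; split; first exact: bounded_reg.
  by eexists; [apply: ExecSet (eval_fits hb hf)|].
- move=> /andP[fa fx] hw; split; first exact: bounded_ram.
  by eexists; [apply: ExecStore (eval_fits hb fa) (eval_fits hb fx)|].
- move=> /andP[f1 f2] [w1 w2]; have [b1 [t1 e1 l1]] := IH1 s hb f1 w1.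
  have [b2 [t2 e2 l2]] := IH2 _ b1 f2 w2; split=> //.
  by exists (t1 + t2); [apply: ExecSeq e1 e2|apply: leq_add].
- move=> /and3P[fx f1 f2] hw; have hx := eval_fits hb fx.
  have [hb' [t' et lt]] : bounded (if ev s x != 0 then run c1 s else run c2 s) /\
      exists2 t', exec (M ^ K) (if ev s x != 0 then c1 else c2) s t'
        (if ev s x != 0 then run c1 s else run c2 s) & t' <= maxn (run_cost c1) (run_cost c2).
    case: ifP hw => _ hw.
      by have [b1 [t1 e1 l1]] := IH1 s hb f1 hw; split=> //; exists t1 => //; rewrite leq_max l1.
    by have [b1 [t1 e1 l1]] := IH2 s hb f2 hw; split=> //; exists t1 => //; rewrite leq_max l1 orbT.
  split=> //; exists ((cost x).+1 + t'); last by rewrite leq_add2l.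
  exact: ExecIf hx et.
- by [].
Qed.

Lemma wp_seq c1 c2 t1 t2 t s Q : wp c1 t1 s (fun s' => wp c2 t2 s' Q) ->
  t1 + t2 <= t -> wp (CSeq c1 c2) t s Q.
Proof.
move=> [t1' [s1 [e1 l1 [t2' [s2 [e2 l2 q]]]]]] lt; exists (t1' + t2'), s2.
by split=> //; [apply: ExecSeq e1 e2|apply: leq_trans lt; apply: leq_add].
Qed.

Lemma wp_weaken c t t' s (Q Q' : state -> Prop) : wp c t s Q -> t <= t' ->
  (forall s', Q s' -> Q' s') -> wp c t' s Q'.
Proof.
move=> [t1 [s1 [e1 l1 q]]] lt h; exists t1, s1.
by split=> //; [apply: leq_trans lt|apply: h].
Qed.

Lemma wp_if x c1 c2 t t1 s Q : bounded s -> fits K x ->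
  (if ev s x != 0 then wp c1 t1 s Q else wp c2 t1 s Q) ->
  (cost x).+1 + t1 <= t -> wp (CIf x c1 c2) t s Q.
Proof.
move=> hb hx h lt.
have [t' [s' [et lt' q]]] : wp (if ev s x != 0 then c1 else c2) t1 s Q by case: ifP h.
exists ((cost x).+1 + t'), s'; split=> //; first exact: ExecIf (eval_fits hb hx) et.
by apply: leq_trans lt; rewrite leq_add2l.
Qed.

(* The invariant carries the time budget that remains. *)
Lemma wp_while x c (Inv : nat -> state -> Prop) Q t s : fits K x ->
  (forall t s, Inv t s -> bounded s /\
     if ev s x != 0 then exists t1 t2, (cost x).+1 + t1 + t2 <= t /\ wp c t1 s (Inv t2)
     else (cost x).+1 <= t /\ Q s) ->
  Inv t s -> wp (CWhile x c) t s Q.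
Proof.
move=> hx hI; elim/ltn_ind: t s => t IH s hs.
have [hb] := hI t s hs; case: ifP => hv.
  move=> [t1 [t2 [lt [t1' [s1 [e1 l1 i1]]]]]].
  have [t2' [s2 [e2 l2 q]]] : wp (CWhile x c) t2 s1 Q by apply: IH => //; lia.
  exists ((cost x).+1 + t1' + t2'), s2; split=> //; last by lia.
  exact: ExecWhile (eval_fits hb hx) hv e1 e2.
move=> [lt q]; exists (cost x).+1, s; split=> //.
by apply: ExecWhileEnd; rewrite eval_fits // ; move/negbFE/eqP: hv => ->.
Qed.

End Machine.

(** * The program and its search phase *)

(* Vertex i is represented by the word i + 1.  Register 2 holds n; the words at
   5n + j, 7n + j and 9n + k are the parent of j, the size of the subtree of j
   and the k-th entry of the queue.  Registers 3 and 4 are the ends of the queue,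
   later 3 runs through the vertices; (5, 9) is a dart of a cut, (7, 8) a dart that
   moves around a face; 10 and 11 add up the flows across the cut in the two
   directions, 12 counts its edges. *)
Definition addr (k : nat) (j : expr) : expr := EAdd (EMul (EConst k) (EReg 2)) j.
(** The record of vertex i starts with its corner at address 4 i + 1; in terms of the word i + 1,
    slot s is at 4 (i + 1) + s - 2. *)
Definition slotx (j s : expr) : expr := ELoad (ESub (EAdd (EMul (EConst 4) j) s) (EConst 2)).
Definition block (l : seq com) : com := foldr CSeq CSkip l.

(** The root has word 1. Its parent n + 1 is nonzero, which marks it as visited, and names no
    vertex, so that [subtree_sizes] passes the size of the root to a cell outside the table. *)
Definition init : com := block
  [:: CSet 2 (ELoad (EConst 0));
      CStore (addr 5 (EConst 1)) (EAdd (EReg 2) (EConst 1));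
      CStore (addr 9 (EConst 0)) (EConst 1);
      CSet 4 (EConst 1)].

(** The condition is nonzero exactly if the neighbour exists and has no parent yet. *)
Definition push (s : nat) : com := block
  [:: CSet 6 (slotx (EReg 5) (EConst s));
      CIf (EMul (EReg 6) (ESub (EConst 1) (ELoad (addr 5 (EReg 6)))))
        (block [:: CStore (addr 5 (EReg 6)) (EReg 5);
                   CStore (addr 9 (EReg 4)) (EReg 6);
                   CSet 4 (EAdd (EReg 4) (EConst 1))])
        CSkip].

Definition search : com :=
  CWhile (ESub (EReg 4) (EReg 3)) (block
    [:: CSet 5 (ELoad (addr 9 (EReg 3)));
        CSet 3 (EAdd (EReg 3) (EConst 1));
        push 0; push 1; push 2]).

(** The queue is read backwards, so a vertex has received the sizes of all its children when its
    turn comes. *)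
Definition count_step : com := block
    [:: CSet 3 (ESub (EReg 3) (EConst 1));
        CSet 5 (ELoad (addr 9 (EReg 3)));
        CStore (addr 7 (EReg 5)) (EAdd (ELoad (addr 7 (EReg 5))) (EConst 1));
        CSet 6 (ELoad (addr 5 (EReg 5)));
        CStore (addr 7 (EReg 6))
          (EAdd (ELoad (addr 7 (EReg 6))) (ELoad (addr 7 (EReg 5))))].

Definition subtree_sizes : com := CWhile (EReg 3) count_step.

(** Truncated subtraction replaces tests. On slots, [nxx] maps 0, 1, 2 to 0, 2, 1 and [rsx] maps
    them to 1, 0, 2, as [nx] and [rs] do. *)
Definition nonzero (x : expr) : expr := ESub (EConst 1) (ESub (EConst 1) x).
Definition same (x y : expr) : expr :=
  ESub (EConst 1) (EAdd (ESub x y) (ESub y x)).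
Definition nxx (s : expr) : expr := EMul (ESub (EConst 3) s) (nonzero s).
Definition rsx (s : expr) : expr :=
  EAdd (ESub (EConst 1) s) (EMul (EConst 2) (ESub s (EConst 1))).

(** From word 0, an absent vertex, [slotx] reads an unrelated cell; the factor [nonzero] keeps the
    word 0. *)
Definition turn : com := block
  [:: CSet 7 (EMul (slotx (EReg 7) (EReg 8)) (nonzero (EReg 7)));
      CSet 8 (nxx (EReg 8))].

Definition turns (k : nat) : com := iter k (CSeq turn) CSkip.

(** One tour of 8 steps tests whether the face is complete and passes the next dart on the way:
    after 3 steps for a square and after 5 for an octagon, the values of [face_half]. *)
Definition advance : com := block
  [:: CSet 7 (EReg 5); CSet 8 (EReg 9);
      turns 3; CSet 13 (EReg 7); turns 2; CSet 14 (EReg 7); turns 3;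
      CIf (EReg 7) (CIf (EReg 9) (CSet 5 (EReg 14)) (CSet 5 (EReg 13)))
        (CSet 5 (EConst 0));
      CSet 9 (rsx (EReg 9))].

Definition cross : com := block
  [:: CSet 6 (slotx (EReg 5) (EReg 9));
      CSet 12 (EAdd (EReg 12) (EConst 1));
      CSet 10 (EAdd (EReg 10) (EMul (same (ELoad (addr 5 (EReg 6))) (EReg 5))
                                    (ELoad (addr 7 (EReg 6)))));
      CSet 11 (EAdd (EReg 11) (EMul (same (ELoad (addr 5 (EReg 5))) (EReg 6))
                                    (ELoad (addr 7 (EReg 5)))))].

Definition chain : com := CSeq
  (block [:: CSet 10 (EConst 0); CSet 11 (EConst 0); CSet 12 (EConst 0)])
  (CSeq (CWhile (EReg 5) (CSeq cross advance))
  (block [:: CSet 15 (ESub (EReg 10) (EReg 11));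
             CSet 15 (EMul (EReg 15) (ESub (EReg 2) (EReg 15)));
             CSet 0 (EAdd (EReg 0) (EReg 15));
             CSet 1 (EAdd (EReg 1) (EMul (EReg 12) (EReg 15)))])).

(** The eight turns, from the head in the reverse direction, go around the right face; a chain is
    walked only if they fail. *)
Definition from_dart (s : nat) : com := CSeq
  (block [:: CSet 5 (EReg 3); CSet 9 (EConst s);
             CSet 6 (slotx (EReg 3) (EConst s));
             CSet 7 (EReg 6); CSet 8 (EConst (rs s)); turns 8])
  (CIf (EReg 6) (CIf (EReg 7) CSkip chain) CSkip).

Definition sum_cuts : com := CSeq (CSet 3 (EReg 2))
  (CWhile (EReg 3)
    (CSeq (from_dart 0) (CSeq (from_dart 1) (CSeq (from_dart 2)
       (CSet 3 (ESub (EReg 3) (EConst 1))))))).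

Definition index_program : com := CSeq init (CSeq search (CSeq subtree_sizes sum_cuts)).

Definition o2n n (o : option 'I_n) : nat := if o is Some j then j.+1 else 0.

Section Words.
Variable n : nat.
Hypothesis n_ge3 : 2 < n.
Local Notation M := (n ^ 6).

(** Register 1 grows at most 3n times by at most 3n edges times n * n, which gives 9 n^4; since n >=
    3, the factor 9 is at most n^2. *)
Lemma word_size : 9 * n ^ 4 <= M.
Proof. by rewrite -[6]/(2 + 4) expnD leq_mul2r -[9]/(3 ^ 2) leq_exp2r // n_ge3 orbT. Qed.

Lemma word_quad : 9 * (n * n) <= M.
Proof.
apply: leq_trans word_size; rewrite leq_mul2l /= mulnn leq_pexp2l //.
exact: leq_trans n_ge3.
Qed.

Lemma word_lin : 27 * n <= M.
Proof. by have := word_quad; have := n_ge3; nia. Qed.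

Lemma word9 : 9 <= M. Proof. by have := word_lin; have := n_ge3; lia. Qed.

End Words.

(** * Breadth-first search *)

Section Run.
Variables (n : nat) (pos : 'I_n -> netv) (e : rel 'I_n).
Hypothesis cs : cut_system pos e.

Local Notation nbr := (nbr pos e).
Local Notation ostep := (ostep pos e).
Local Notation M := (n ^ 6).
Local Notation bounded := (bounded M).
Local Notation wp := (wp M 10).

Let n_ge3 : 2 < n := cs_size cs.
Let word_lin := word_lin n_ge3.
Let word9 := word9 n_ge3.

Definition input_ok (m : nat -> nat) : Prop :=
  forall (i : 'I_n) s, s < 3 -> m (4 * i.+1 + s - 2) = o2n (nbr i s).

Lemma o2n_le (o : option 'I_n) : o2n o <= n.
Proof. by case: o => [[]|]. Qed.

Lemma run_turns k o s st : input_ok (ram st) -> s < 3 -> regs st 7 = o2n o -> regs st 8 = s ->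
  let st' := run (turns k) st in
  [/\ writes_le M (turns k) st, ram st' = ram st,
      regs st' 7 = o2n (iter k ostep (o, s)).1,
      regs st' 8 = (iter k ostep (o, s)).2 &
      forall i, i != 7 -> i != 8 -> regs st' i = regs st i].
Proof.
elim: k o s st => [|k IH] o s st hin hs h7 h8; first by split.
rewrite !(iterSr k ostep) /=; set st1 := set_reg _ 8 _.
have e7 : regs st1 7 = o2n (obind (nbr^~ s) o).
  rewrite /st1 /= /upd /= h7 h8; case: o {h7} => [i|] /=; last by rewrite subn0 subnn muln0.
  by rewrite hin // subSS sub0n subn0 muln1.
have e8 : regs st1 8 = nx s.
  by rewrite /st1 /= /upd /= h8; case: s hs {h8 e7} => [|[|[|]]].
have := IH (obind (nbr^~ s) o) (nx s) st1 hin (nx_lt3 s) e7 e8.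
rewrite -/(turns k) => -[w hr h7' h8' ho].
have ew : ram st (4 * regs st 7 + regs st 8 - 2) * (1 - (1 - regs st 7)) = regs st1 7.
  by rewrite /st1 /= /upd.
have ew8 : (3 - regs st 8) * (1 - (1 - regs st 8)) = regs st1 8 by rewrite /st1 /= /upd.
split=> //.
- split=> //; split; last split=> //.
    by rewrite ew e7; apply: leq_trans (o2n_le _) _; have := word_lin; lia.
  by rewrite /upd /= ew8 e8; have := nx_lt3 s; have := word9; lia.
- move=> i i7 i8; rewrite ho // /st1 /= /upd; by rewrite (negPf i7) (negPf i8).
Qed.

Variable r : 'I_n.

(** Parents stand earlier in the queue, which makes the parent function acyclic. The block from 7n
    to 9n is kept zero for the subtree sizes. *)
Record bfs_inv (q : seq 'I_n) (h : nat) (st : state) : Prop := BfsInv {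
  bi_bnd : bounded st;
  bi_in : input_ok (ram st);
  bi_n : regs st 2 = n;
  bi_h : regs st 3 = h;
  bi_t : regs st 4 = size q;
  bi_out : regs st 0 = 0 /\ regs st 1 = 0;
  bi_uniq : uniq q;
  bi_pos : 0 < size q /\ nth r q 0 = r;
  bi_q : forall k, k < size q -> ram st (9 * n + k) = (nth r q k).+1;
  bi_new : forall i : 'I_n, i \notin q -> ram st (5 * n + i.+1) = 0;
  bi_root : ram st (5 * n + r.+1) = n.+1;
  bi_par : forall k, 0 < k < size q -> exists k', [/\ k' < k, e (nth r q k') (nth r q k) &
     ram st (5 * n + (nth r q k).+1) = (nth r q k').+1];
  bi_zero : forall a, 7 * n <= a < 9 * n -> ram st a = 0 }.

Lemma uniq_size (q : seq 'I_n) : uniq q -> size q <= n.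
Proof. by move=> /card_uniqP <-; have := max_card [in q]; rewrite card_ord. Qed.

Lemma bfs_inv_reg q h st i v : bfs_inv q h st -> 4 < i -> v <= M -> bfs_inv q h (set_reg st i v).
Proof.
move=> [h1 h2 h3 h4 h5 h6 h7 h8 h9 h10 h11 h12 h13] hi hv.
have hu k : k < 5 -> upd (regs st) i v k = regs st k.
  by move=> hk; rewrite /upd; case: eqP => // ei; lia.
by split=> //=; rewrite ?hu //; apply: bounded_reg.
Qed.

Lemma bfs_visited q h st (i : 'I_n) : bfs_inv q h st -> (ram st (5 * n + i.+1) == 0) = (i \notin q).
Proof.
move=> B; apply/eqP/idP => [hz|]; last exact: bi_new B i.
apply/negP => /(nthP r)[[|k] hk ei].
  by move: hz; rewrite -ei (proj2 (bi_pos B)) (bi_root B).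
have [k' [_ _ hp]] := bi_par B (k := k.+1) hk.
by move: hz; rewrite -ei hp.
Qed.

Lemma push_ok s q h k0 st t : s < 3 -> bfs_inv q h st -> k0 < size q ->
  regs st 5 = (nth r q k0).+1 -> 60 <= t ->
  wp (push s) t st (fun st' => exists q1, let q' := q ++ q1 in
    [/\ bfs_inv q' h st', regs st' 5 = regs st 5 &
        forall j, nbr (nth r q k0) s = Some j -> j \in q']).
Proof.
move=> hs B hk0 h5 ht; set u := nth r q k0 in h5 *.
have hin := bi_in B u hs; have hn := bi_n B.
have wl := word_lin.
have vle : o2n (nbr u s) <= M by have := o2n_le (nbr u s); lia.
have fin0 : fits_com 10 (push s) by case: s hs {hin vle} => [|[|[|]]].
have cost0 : run_cost (push s) <= t.
  by apply: leq_trans ht; case: s hs {hin vle fin0} => [|[|[|]]].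
apply: wp_run (bi_bnd B) fin0 _ cost0 _; first exact: word9.
  rewrite /push /= /upd /= h5 hin hn.
  have un := ltn_ord u; have qn := uniq_size (bi_uniq B).
  split=> //; split=> //; case: ifP => // _.
  by split; [lia | split=> //; split=> //; rewrite (bi_t B); lia].
rewrite /push /= /upd /= h5 hin hn; case Ej : (nbr u s) => [j|] /= hb'; last first.
  exists [::]; rewrite cats0; split=> //; first exact: bfs_inv_reg.
have jle : j.+1 <= M by have := ltn_ord j; lia.
have jn := ltn_ord j; have un := ltn_ord u; have qn := uniq_size (bi_uniq B).
have [jq|jq] := boolP (j \in q).
  have : ram st (5 * n + j.+1) != 0 by rewrite (bfs_visited _ B) jq.
  rewrite -lt0n => hp; have -> : 1 - ram st (5 * n + j.+1) = 0 by lia.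
  rewrite muln0 /=; exists [::]; rewrite cats0; split=> //; first exact: bfs_inv_reg.
  by move=> j' [<-].
have hj0 : ram st (5 * n + j.+1) = 0 by apply: bi_new B j jq.
move: hb'; rewrite hj0 subn0 muln1 /= (bi_t B) => hb'.
set st' := set_reg _ 4 _ in hb' *.
have rm a : ram st' a = if a == 9 * n + size q then j.+1
    else if a == 5 * n + j.+1 then u.+1 else ram st a by [].
have rg i : i != 4 -> i != 6 -> regs st' i = regs st i.
  by move=> h4 h6; rewrite /st' /= /upd (negPf h4) (negPf h6).
have nj i : i \in q -> (5 * n + i.+1 == 5 * n + j.+1) = false.
  by move=> hi; apply/negP => /eqP/addnI[] /val_inj ei; rewrite -ei hi in jq.
have lt9 (i : 'I_n) : (5 * n + i.+1 == 9 * n + size q) = false by have := ltn_ord i; lia.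
have nq k : k < size q -> nth r (rcons q j) k = nth r q k by move=> hk; rewrite nth_rcons hk.
have nqs : nth r (rcons q j) (size q) = j by rewrite nth_rcons ltnn eqxx.
exists [:: j]; rewrite cats1; split=> //; last by move=> j' [<-]; rewrite mem_rcons mem_head.
have [q0 q0r] := bi_pos B.
split=> //; rewrite ?size_rcons.
- move=> i t0 ht0; rewrite rm.
  by have := ltn_ord i; do 2 (case: eqP => [|_]; first by lia); move=> _; apply: (bi_in B).
- by rewrite rg // (bi_h B).
- by rewrite /st' /= /upd /= addn1.
- by rewrite !rg //; apply: bi_out B.
- by rewrite rcons_uniq jq (bi_uniq B).
- by rewrite nq.
- move=> k; rewrite ltnS leq_eqVlt => /orP[/eqP ->|hk]; first by rewrite nqs rm eqxx.
  rewrite nq // rm; case: eqP => [|_]; first by lia.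
  by case: eqP => [|_]; [have := n_ge3; lia|apply: bi_q B k hk].
- move=> i; rewrite mem_rcons inE negb_or => /andP[ij iq]; rewrite rm lt9.
  by case: eqP => [/addnI[] /val_inj ei|_]; [rewrite ei eqxx in ij|apply: bi_new B i iq].
- by rewrite rm lt9 nj ?(bi_root B) // -q0r mem_nth.
- move=> k /andP[k1]; rewrite ltnS leq_eqVlt => /orP[/eqP ek|hk].
    exists k0; rewrite ek nqs nq //; split=> //; last by rewrite rm lt9 eqxx.
    by case: (nbrP e u j s (cs_inj cs)) => /(_ Ej)[].
  have [k' [kk' he hp]] := bi_par B (k := k) ltac:(by rewrite k1).
  exists k'; rewrite !nq //; last exact: ltn_trans hk.
  by split=> //; rewrite rm lt9 nj ?mem_nth.
- move=> a ha; rewrite rm; do 2 (case: eqP => [|_]; first by lia).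
  exact: bi_zero B a ha.
Qed.

Definition closed_upto (q : seq 'I_n) (h : nat) : Prop :=
  forall k, k < h -> forall j, e (nth r q k) j -> j \in q.

Lemma search_ok st t : bfs_inv [:: r] 0 st -> 300 * n + 100 <= t ->
  wp search t st (fun st' => exists2 q, bfs_inv q n st' & size q = n).
Proof.
move=> B0 ht.
pose Inv t st := exists q h, [/\ bfs_inv q h st, closed_upto q h, h <= size q &
   300 * (n - h) + 100 <= t].
apply: (wp_while word9 (Inv := Inv)) => //; last first.
  by exists [:: r], 0; split=> //; rewrite subn0.
move=> {B0 ht st t} t st [q [h [B cl hq ht]]]; split; first exact: bi_bnd B.
rewrite /= (bi_t B) (bi_h B); case: ifP => hc; last first.
  split; first by lia.
  have eh : h = size q by lia.
  (* With the queue exhausted, [q] contains the root and is closed under adjacency, so connectedness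
     puts every vertex into it. *)
  have allq j : j \in q.
    have : connect e r j by apply: cs_connect cs r j.
    move=> /connectP[p hp ->].
    have : r \in q by have [q0 <-] := bi_pos B; rewrite mem_nth.
    elim: p r hp => [|y p IH] x //= /andP[hxy hp] hx; apply: IH => //.
    move/(nthP r): hx => [k hk ek]; apply: (cl k); first by rewrite eh.
    by rewrite ek.
  have sq : size q = n.
    rewrite -(card_uniqP (bi_uniq B)) -[RHS]card_ord; apply: eq_card => j.
    by rewrite allq.
  by exists q => //; rewrite -sq -eh.
have hlt : h < size q by lia.
have qn := uniq_size (bi_uniq B).
exists 260, (300 * (n - h.+1) + 100); split; first by lia.
have wl := word_lin.
apply: (wp_seq (t1 := 10) (t2 := 250)) => //.
apply: wp_run (bi_bnd B) _ _ _ _ => //=.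
  by rewrite (bi_n B) (bi_h B) (bi_q B) //; have := ltn_ord (nth r q h); lia.
rewrite (bi_n B) (bi_h B) (bi_q B) // => hb1.
apply: (wp_seq (t1 := 10) (t2 := 240)) => //.
apply: wp_run hb1 _ _ _ _ => //=.
  by rewrite /upd /= (bi_h B); lia.
rewrite /upd /= (bi_h B) => hb2.
set st2 := set_reg _ 3 _ in hb2 *.
have B2 : bfs_inv q h.+1 st2.
  have [h1 h2 h3 h4 h5 h6 h7 h8 h9 h10 h11 h12 h13] := B.
  by split=> //; rewrite /st2 /= /upd /= addn1.
have e5 : regs st2 5 = (nth r q h).+1 by [].
apply: (wp_seq (t1 := 60) (t2 := 180)) => //.
apply: (wp_weaken (push_ok (s := 0) (t := 60) isT B2 hlt e5 isT)) => // st3.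
move=> [q1 [B3 e3 n3]].
have nn qq : nth r (q ++ qq) h = nth r q h by rewrite nth_cat hlt.
have ln qq : h < size (q ++ qq) by rewrite size_cat ltn_addr.
have f3 : regs st3 5 = (nth r (q ++ q1) h).+1 by rewrite e3 e5 nn.
apply: (wp_seq (t1 := 60) (t2 := 120)) => //.
apply: (wp_weaken (push_ok (s := 1) (t := 60) isT B3 (ln q1) f3 isT)) => // st4.
move=> [q2 [B4 e4 n4]]; rewrite -catA in B4 n4.
have f4 : regs st4 5 = (nth r (q ++ q1 ++ q2) h).+1 by rewrite e4 e3 e5 nn.
apply: (wp_seq (t1 := 60) (t2 := 60)) => //.
apply: (wp_weaken (push_ok (s := 2) (t := 60) isT B4 (ln _) f4 isT)) => // st5.
move=> [q3 [B5 e5' n5]]; rewrite -!catA in B5 n5.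
apply: wp_run (bi_bnd B5) _ _ _ _ => //=.
move=> _; exists (q ++ q1 ++ q2 ++ q3), h.+1; split=> //.
move=> k; rewrite ltnS leq_eqVlt => /orP[/eqP ->|hk] j; last first.
  by rewrite nth_cat (ltn_trans hk hlt) => /(cl k hk) jq; rewrite mem_cat jq.
rewrite nn => he; have [s hs hp] := cs_net cs he.
have hj : nbr (nth r q h) s = Some j by apply/nbrP; [exact: cs_inj cs|].
rewrite !nn in n4 n5.
case: s hs hp hj => [|[|[|//]]] _ _ hj.
- by have := n3 j hj; rewrite !mem_cat => /orP[] ->; rewrite ?orbT.
- by have := n4 j hj; rewrite !mem_cat => /or3P[] ->; rewrite ?orbT.
- by have := n5 j hj.
Qed.

End Run.

(** * Subtree sizes *)

Section Count.
Variables (n : nat) (pos : 'I_n -> netv) (e : rel 'I_n) (r : 'I_n).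
Hypothesis cs : cut_system pos e.

Local Notation M := (n ^ 6).
Local Notation bounded := (bounded M).
Local Notation wp := (wp M 10).

Definition parent_word (par : 'I_n -> option 'I_n) (i : 'I_n) : nat :=
  if par i is Some u then u.+1 else n.+1.

Record search_tree (q : seq 'I_n) (par : 'I_n -> option 'I_n) : Prop := SearchTree {
  tr_uniq : uniq q;
  tr_size : size q = n;
  tr_all : forall v, v \in q;
  tr_first : index r q = 0;
  tr_root : forall v, (par v == None) = (v == r);
  tr_edge : forall u v, par v = Some u -> e u v;
  tr_lt : forall u v, par v = Some u -> index u q < index v q }.

Lemma bfs_tree q st : bfs_inv pos e r q n st -> size q = n ->
  exists2 par, search_tree q par &
    forall i : 'I_n, ram st (5 * n + i.+1) = parent_word par i.
Proof.
move=> B sq; have uq := bi_uniq B; have [q0 qr] := bi_pos B.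
have allq i : i \in q.
  have hc : #|q| = #|'I_n| by rewrite (card_uniqP uq) sq card_ord.
  by have /(subset_cardP hc) -> : q \subset 'I_n by apply/subsetP.
pose par (i : 'I_n) : option 'I_n := [pick u : 'I_n | ram st (5 * n + i.+1) == u.+1].
have ir : index r q = 0 by rewrite -[in LHS]qr index_uniq.
have parr : par r = None.
  rewrite /par; case: pickP => // u; rewrite (bi_root B) eqSS => /eqP eu.
  by have := ltn_ord u; rewrite -eu ltnn.
have parn i : i != r -> exists u, [/\ par i = Some u, index u q < index i q, e u i &
    ram st (5 * n + i.+1) = u.+1].
  move=> ir'; have hi : index i q < size q by rewrite index_mem allq.
  have hk : 0 < index i q < size q.
    rewrite hi andbT lt0n; apply: contra ir' => /eqP i0; apply/eqP.
    by rewrite -(nth_index r (allq i)) i0.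
  have [k' [kk he hp]] := bi_par B hk; rewrite nth_index // in he hp.
  have hk' := ltn_trans kk hi.
  exists (nth r q k'); rewrite index_uniq //; split=> //.
  rewrite /par; case: pickP => [u|/(_ (nth r q k'))]; rewrite hp ?eqxx // eqSS => /eqP eu.
  by congr Some; apply: val_inj.
exists par; last first.
  move=> i; rewrite /parent_word; have [->|/parn[u [-> _ _ ->]]//] := eqVneq i r.
  by rewrite parr (bi_root B).
split=> // [v|u v hv|u v hv].
- by have [->|/parn[u [-> _ _ _]]//] := eqVneq v r; rewrite parr.
- by have [ev|/parn[u' [hv' _ he _]]] := eqVneq v r; [rewrite ev parr in hv|move: hv; rewrite hv' => -[<-]].
- by have [ev|/parn[u' [hv' he _ _]]] := eqVneq v r; [rewrite ev parr in hv|move: hv; rewrite hv' => -[<-]].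
Qed.

Section Sizes.
Variables (q : seq 'I_n) (par : 'I_n -> option 'I_n) (mem0 : nat -> nat).
Hypothesis T : search_tree q par.
Hypothesis mem_q : forall k, k < n -> mem0 (9 * n + k) = (nth r q k).+1.
Hypothesis mem_par : forall i : 'I_n, mem0 (5 * n + i.+1) = parent_word par i.

Definition size_at (m : nat -> nat) (i : 'I_n) : nat := m (7 * n + i.+1).

(** The vertices at queue positions [m] and above are done. A cell holds the sizes of the done
    children, and one unit more once its own vertex is done. By [ci_sum], what the other vertices
    hold is at most the number of done vertices; this keeps all cells at most n. The sink belongs to
    the word n + 1 and is written only for the root, which comes last. *)
Record count_inv (m : nat) (st : state) : Prop := CountInv {
  ci_bnd : bounded st;
  ci_mem : forall a, ~~ (7 * n <= a < 9 * n) -> ram st a = mem0 a;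
  ci_n : regs st 2 = n;
  ci_m : regs st 3 = m /\ m <= n;
  ci_out : regs st 0 = 0 /\ regs st 1 = 0;
  ci_sink : 0 < m -> ram st (7 * n + n.+1) = 0;
  ci_flow : forall i, size_at (ram st) i = (m <= index i q) +
     \sum_(c | (par c == Some i) && (m <= index c q)) size_at (ram st) c;
  ci_sum : \sum_(i | index i q < m) size_at (ram st) i <= n - m;
  ci_le : forall i, size_at (ram st) i <= n }.

Lemma count_step_ok m st : count_inv m.+1 st -> wp count_step 100 st (count_inv m).
Proof.
move=> C; have [hm mn] := ci_m C; have n3 := cs_size cs; have wl := word_lin n3.
move eu: (nth r q m) => u; have un := ltn_ord u.
have iu : index u q = m by rewrite -eu index_uniq ?(tr_uniq T) // (tr_size T).
have eq_m (i : 'I_n) : index i q = m -> i = u.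
  by move=> ei; rewrite -eu -(nth_index r (tr_all T i)) ei.
have mq : ram st (9 * n + m) = u.+1 by rewrite (ci_mem C) ?mem_q ?eu //; lia.
have mp : ram st (5 * n + u.+1) = parent_word par u by rewrite (ci_mem C) ?mem_par //; lia.
pose S := size_at (ram st); pose pu := parent_word par u.
have punu : pu != u.+1.
  rewrite /pu /parent_word; case hp: (par u) => [w|]; last by lia.
  by have := tr_lt T hp; apply: contraTN => /eqP[] /val_inj ->; rewrite ltnn.
have pun : pu <= n.+1 by rewrite /pu /parent_word; case: (par u) => [w|] //; have := ltn_ord w; lia.
have Su : ram st (7 * n + u.+1) = S u by [].
have sum1 : \sum_(i | index i q < m.+1) S i = S u + \sum_(i | index i q < m) S i.
  rewrite (bigD1 u) /= ?iu //; congr (_ + _); apply: eq_bigl => i.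
  apply/idP/idP => [/andP[h1 h2]|h].
    by rewrite ltn_neqAle -ltnS h1 andbT; apply: contra h2 => /eqP/eq_m ->.
  by rewrite ltnW //=; apply: contraTN h => /eqP ->; rewrite iu ltnn.
have ub := ci_sum C; rewrite -/S sum1 in ub.
have wle w : par u = Some w -> S w <= \sum_(i | index i q < m) S i.
  by move=> hp; have := tr_lt T hp; rewrite iu => hw; rewrite (bigD1 w) //= leq_addr.
(* Both [u] and its parent are still among the vertices summed in [ci_sum]; for the root, the sink
   is still 0. *)
have pS : ram st (7 * n + pu) + (S u + 1) <= n.
  rewrite /pu /parent_word; case hp: (par u) => [w|]; last by rewrite (ci_sink C) //; lia.
  by rewrite -/(size_at (ram st) w) -/(S w); have := wle w hp; lia.
have upd7 : (7 * n + pu == 7 * n + u.+1) = false by apply/negbTE; rewrite eqn_add2l.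
have upd7' : (7 * n + u.+1 == 7 * n + pu) = false by rewrite eq_sym.
apply: wp_run (ci_bnd C) _ _ _ _ => //.
- exact: word9 n3.
- rewrite /= /upd /= hm (ci_n C) subn1 /= mq Su.
  have -> : (5 * n + u.+1 == 7 * n + u.+1) = false by lia.
  rewrite mp -/pu upd7 eqxx; do !split=> //; try lia.
rewrite /= /upd /= hm (ci_n C) subn1 /= mq Su.
have -> : (5 * n + u.+1 == 7 * n + u.+1) = false by lia.
rewrite mp -/pu upd7 eqxx; set st' := set_ram _ _ _ => hb.
have rm a : ram st' a = if a == 7 * n + pu then ram st (7 * n + pu) + (S u + 1)
   else if a == 7 * n + u.+1 then S u + 1 else ram st a by [].
pose S' := size_at (ram st').
have S'E i : S' i = if i == u then S u + 1 else if par u == Some i then S i + (S u + 1) else S i.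
  rewrite /S' /size_at rm !eqn_add2l eqSS -val_eqE /=.
  have [->|iu'] := eqVneq i u; first by rewrite eqxx eq_sym (negPf punu).
  have -> : (val i == val u) = false by rewrite val_eqE (negPf iu').
  rewrite /pu /parent_word; case hp: (par u) => [w|] /=.
    rewrite eqSS val_eqE (inj_eq (@Some_inj _)) eq_sym.
    by case: eqP => // ->; rewrite /S /size_at.
  by have := ltn_ord i; case: eqP => // ->; lia.
have S'big (i : 'I_n) : m < index i q -> S' i = S i.
  move=> hi; rewrite S'E; case: eqP => [ei|_]; first by rewrite ei iu ltnn in hi.
  case: eqP => // hp; have := tr_lt T hp; rewrite iu => h.
  by have := ltn_trans hi h; rewrite ltnn.
split=> //.
- move=> a ha; rewrite rm; case: eqP => [ea|_]; first by lia.
  by case: eqP => [ea|_]; [lia|apply: ci_mem C a ha].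
- exact: ci_n C.
- by split=> //; apply: ltnW.
- exact: ci_out C.
- move=> m0; rewrite rm; have [hp|hp] := eqVneq (par u) None.
    have ur : u = r by apply/eqP; rewrite -(tr_root T) hp.
    by move: m0; rewrite -iu ur (tr_first T).
  rewrite /pu /parent_word; case: (par u) hp => [w|] // _.
  have wn := ltn_ord w; do 2 (case: eqP => [|_]; first by lia); exact: (ci_sink C).
- move=> i; rewrite -/S' -/(S' i).
  have -> : \sum_(c | (par c == Some i) && (m <= index c q)) S' c = (par u == Some i) * (S u + 1)
      + \sum_(c | (par c == Some i) && (m < index c q)) S c.
    rewrite big_mkcond [in RHS]big_mkcond (bigD1 u) //= [in RHS](bigD1 u) //= iu leqnn ltnn.
    rewrite andbT andbF add0n S'E eqxx; congr (_ + _); first by case: eqP; rewrite ?mul1n.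
    apply: eq_bigr => c cu; rewrite leq_eqVlt.
    have -> : (m == index c q) = false by apply/negP => /eqP/esym/eq_m ec; rewrite ec eqxx in cu.
    by case: ifP => // /andP[_ /S'big].
  have := ci_flow C i; rewrite -/S -/(S i) S'E => hS.
  have [ei|iu'] := eqVneq i u.
    have hpu : (par u == Some i) = false.
      by apply/negP => /eqP hp; have := tr_lt T hp; rewrite ei ltnn.
    by move: hS; rewrite hpu ei iu ltnn leqnn; lia.
  have -> : (m <= index i q) = (m < index i q).
    by rewrite leq_eqVlt; case: eqP => // /esym/eq_m ei; rewrite ei eqxx in iu'.
  move: hS; set Y := bigop.body _ _ _ => ->.
  by case: (par u == Some i); rewrite ?mul1n ?mul0n; lia.
- rewrite -/S'; case hp: (par u) => [w|]; last first.
    rewrite (eq_bigr S) => [|i hi].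
      by apply: leq_trans (leq_trans (leq_addl _ _) ub) _; lia.
    by rewrite S'E hp; case: eqP => // ei; rewrite ei iu ltnn in hi.
  have hw := tr_lt T hp; rewrite iu in hw.
  have wu : w != u by apply: contraTN hw => /eqP ->; rewrite iu ltnn.
  move: ub; rewrite (bigD1 w) //= [X in _ -> X <= _](bigD1 w) //= S'E (negPf wu) hp eqxx.
  rewrite [X in _ -> _ + X <= _](eq_bigr S) => [|i /andP[hi iw]]; first by lia.
  rewrite S'E hp (inj_eq (@Some_inj _)) (eq_sym w) (negPf iw); case: eqP => // ei.
  by rewrite ei iu ltnn in hi.
- move=> i; rewrite -/(S' i) S'E; case: eqP => _; first by lia.
  case: eqP => [hp|_]; last exact: ci_le C i.
  by have := wle i hp; lia.
Qed.

Lemma count_ok st t : count_inv n st -> 110 * n + 10 <= t -> wp subtree_sizes t st (count_inv 0).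
Proof.
move=> C ht; have n3 := cs_size cs.
pose Inv t st := exists2 m, count_inv m st & 110 * m + 10 <= t.
apply: (wp_while (word9 n3) (Inv := Inv)) => //; last by exists n.
move=> {C ht st t} t st [m C ht]; split; first exact: ci_bnd C.
have [hm _] := ci_m C; rewrite /= hm; case: m C ht hm => [|m] C ht hm /=; first by split=> //; lia.
exists 100, (110 * m + 10); split; first by lia.
by apply: wp_weaken (count_step_ok C) _ _ => // s h; exists m.
Qed.

End Sizes.
End Count.

(** * Walking along the cuts *)

Section WhileSteps.
Variables (M K : nat).
Hypothesis M9 : 9 <= M.

Lemma wp_loop x c t1 t2 t s Q : bounded M s -> fits K x -> ev s x != 0 ->
  wp M K c t1 s (fun s' => wp M K (CWhile x c) t2 s' Q) -> (cost x).+1 + t1 + t2 <= t ->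
  wp M K (CWhile x c) t s Q.
Proof.
move=> hb hx hv [t1' [s1 [e1 l1 [t2' [s2 [e2 l2 q]]]]]] lt.
exists ((cost x).+1 + t1' + t2'), s2; split=> //; last by lia.
exact: ExecWhile (eval_fits M9 hb hx) hv e1 e2.
Qed.

Lemma wp_exit x c t s (Q : state -> Prop) : bounded M s -> fits K x -> ev s x = 0 ->
  Q s -> (cost x).+1 <= t -> wp M K (CWhile x c) t s Q.
Proof.
move=> hb hx hv q lt; exists (cost x).+1, s; split=> //.
by apply: ExecWhileEnd; rewrite (eval_fits M9 hb hx) hv.
Qed.

Lemma wp_set i x t s (Q : state -> Prop) : bounded M s -> fits K x -> ev s x <= M ->
  (cost x).+1 <= t -> (bounded M (set_reg s i (ev s x)) -> Q (set_reg s i (ev s x))) ->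
  wp M K (CSet i x) t s Q.
Proof. by move=> hb hf hw ht hQ; apply: wp_run. Qed.

End WhileSteps.

Section Cuts.
Variables (n : nat) (pos : 'I_n -> netv) (e : rel 'I_n) (r : 'I_n).
Hypothesis cs : cut_system pos e.
Variables (par : 'I_n -> option 'I_n) (sz : 'I_n -> nat) (mem : nat -> nat).
Hypothesis mem_in : input_ok pos e mem.
Hypothesis mem_par : forall i : 'I_n, mem (5 * n + i.+1) = parent_word par i.
Hypothesis mem_sz : forall i : 'I_n, mem (7 * n + i.+1) = sz i.
Hypothesis sz_le : forall i, sz i <= n.

Local Notation M := (n ^ 6).
Local Notation bounded := (bounded M).
Local Notation wp := (wp M 10).
Local Notation dart := ('I_n * 'I_3)%type.
Local Notation nbr := (nbr pos e).
Local Notation ostep := (ostep pos e).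
Local Notation dhead := (dhead pos e).
Local Notation present := (present pos e).
Local Notation drev := (drev pos e).
Local Notation fwd := (fwd pos e).
Local Notation cutrel := (cutrel pos e).
Local Notation start := (start pos e).
Local Notation headside := (headside pos e).

Let n_ge3 : 2 < n := cs_size cs.
Let wl := word_lin n_ge3.
Let w9 := word9 n_ge3.

Definition ready (st : state) : Prop := [/\ bounded st, ram st = mem & regs st 2 = n].

Definition kept (l : seq nat) (st st' : state) : Prop :=
  ready st' /\ forall i, i \in l -> regs st' i = regs st i.

Lemma wp_turns k o s st t (Q : state -> Prop) : ready st -> s < 3 ->
  regs st 7 = o2n o -> regs st 8 = s -> 40 * k + 1 <= t ->
  (forall st', ready st' -> regs st' 7 = o2n (iter k ostep (o, s)).1 ->
     regs st' 8 = (iter k ostep (o, s)).2 ->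
     (forall i, i != 7 -> i != 8 -> regs st' i = regs st i) -> Q st') ->
  wp (turns k) t st Q.
Proof.
move=> [hb hm hn] hs h7 h8 ht hQ.
have hin : input_ok pos e (ram st) by rewrite hm.
have [w e1 e2 e3 e4] := run_turns cs k hin hs h7 h8.
apply: wp_run => //; last first.
  by move=> hb'; apply: hQ => //; split=> //; rewrite ?e1 ?e4.
- apply: leq_trans ht; elim: (k) => // k' IH; rewrite /turns iterS -/(turns k').
  have -> : run_cost (CSeq turn (turns k')) = run_cost turn + run_cost (turns k') by [].
  have : run_cost turn <= 40 by [].
  by lia.
- by elim: (k) => // k' IH; rewrite /turns iterS /= -/(turns k').
Qed.

Lemma ostep_slot_lt k o s : s < 3 -> (iter k ostep (o, s)).2 < 3.
Proof. by case: k => // k _; rewrite iterS nx_lt3. Qed.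

Lemma advance_ok (d : dart) st t (Q : state -> Prop) : ready st ->
  regs st 5 = d.1.+1 -> regs st 9 = d.2 -> 500 <= t ->
  (forall st', kept [:: 0; 1; 3; 10; 11; 12] st st' -> 
     regs st' 5 = o2n (omap fst (fwd d)) -> regs st' 9 = rs d.2 -> Q st') ->
  wp advance t st Q.
Proof.
move=> [hb hm hn] h5 h9 ht hQ; have d1 := ltn_ord d.1; have d2 := ltn_ord d.2.
have oM o : @o2n n o <= M by apply: leq_trans (o2n_le o) _; lia.
apply: (wp_seq (t1 := 10) (t2 := 490)); last by lia.
apply: wp_set => //=; first by rewrite h5; lia.
rewrite h5 => hb1.
apply: (wp_seq (t1 := 10) (t2 := 480)) => //.
apply: wp_set => //=; first by rewrite /upd /= h9; lia.
rewrite /upd /= h9 => hb2; set s2 := set_reg _ 8 _ in hb2 *.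
apply: (wp_seq (t1 := 121) (t2 := 359)) => //.
have rd2 : ready s2 by split.
apply: (wp_turns (k := 3) (o := Some d.1) (s := d.2)) => //.
move=> s3 [hb3 hm3 hn3] e7 e8 rest3; case E3: (iter 3 ostep _) e7 e8 => [o3 t3] /= e7 e8.
have lt3 : t3 < 3 by have := @ostep_slot_lt 3 (Some d.1) d.2 d2; rewrite E3.
apply: (wp_seq (t1 := 10) (t2 := 349)) => //.
apply: wp_set => //=; first by rewrite e7.
rewrite e7 => hb4; set s4 := set_reg _ 13 _ in hb4 *.
apply: (wp_seq (t1 := 81) (t2 := 268)) => //.
have rd4 : ready s4 by split.
apply: (wp_turns (k := 2) (o := o3) (s := t3)) => //.
rewrite -E3 -iterD.
move=> s5 [hb5 hm5 hn5] e7' e8' rest5; case E5: (iter (2 + 3) ostep _) e7' e8' => [o5 t5] /= e7' e8'.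
have lt5 : t5 < 3 by have := @ostep_slot_lt 5 (Some d.1) d.2 d2; rewrite E5.
apply: (wp_seq (t1 := 10) (t2 := 258)) => //.
apply: wp_set => //=; first by rewrite e7'.
rewrite e7' => hb6; set s6 := set_reg _ 14 _ in hb6 *.
apply: (wp_seq (t1 := 121) (t2 := 137)) => //.
have rd6 : ready s6 by split.
apply: (wp_turns (k := 3) (o := o5) (s := t5)) => //.
rewrite -E5 -iterD.
move=> s7 [hb7 hm7 hn7] e7'' _ rest7.
have r9 : regs s7 9 = d.2 by rewrite rest7 // /s6 /= /upd /= rest5 // /s4 /= /upd /= rest3.
have r14 : regs s7 14 = o2n o5 by rewrite rest7 // /s6 /= /upd.
have r13 : regs s7 13 = o2n o3 by rewrite rest7 // /s6 /= /upd /= rest5 // /s4 /= /upd.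
have fE : o2n (omap fst (fwd d)) = if o2n (iter (3 + (2 + 3)) ostep (Some d.1, nat_of_ord d.2)).1 != 0
    then if (nat_of_ord d.2) != 0 then o2n o5 else o2n o3 else 0.
  rewrite /fwd /left_full -[3 + (2 + 3)]/8.
  case: (iter 8 _ _).1 => [j|] //=; rewrite /face_half.
  case: (nat_of_ord d.2 == 0).
    by rewrite E3; case: (o3).
  by rewrite -[5]/(2 + 3) E5; case: (o5).
apply: (wp_seq (t1 := 20) (t2 := 117)) => //.
apply: wp_run => //.
  by rewrite /= e7'' r9 r13 r14; case: ifP => // _; case: ifP.
move=> hb8; set s8 := run _ _ in hb8 *.
have r5 : regs s8 5 = o2n (omap fst (fwd d)).
  by rewrite fE /s8 /= e7'' r9 r13 r14; case: ifP => // _; case: ifP.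
have rest8 i : i != 5 -> regs s8 i = regs s7 i.
  by move=> i5; rewrite /s8 /=; case: ifP => _; [case: ifP => _|]; rewrite /= /upd (negPf i5).
have rm8 : ram s8 = mem by rewrite /s8 /=; case: ifP => _; [case: ifP => _|].
apply: (wp_seq (t1 := 20) (t2 := 97)) => //.
have rsE : ev s8 (rsx (EReg 9)) = rs d.2.
  by rewrite /= rest8 // r9; case: (nat_of_ord d.2) d2 => [|[|[|]]].
apply: wp_set => //; first by rewrite rsE; have := rs_lt3 d2; lia.
rewrite rsE => hb9.
apply: wp_run => // _; apply: hQ => //.
split; first by split; rewrite //= /upd /= rest8.
move=> i hi; rewrite /= /upd.
have ni k : k \notin [:: 0; 1; 3; 10; 11; 12] -> i != k by apply: contraNneq => <-.
rewrite (negPf (ni 9 isT)) rest8 ?ni // rest7 ?ni // /s6 /= /upd (negPf (ni 14 isT)) rest5 ?ni //.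
by rewrite /s4 /= /upd (negPf (ni 13 isT)) rest3 ?ni // /s2 /= /upd (negPf (ni 8 isT)) (negPf (ni 7 isT)).
Qed.

Lemma cross_ok (d : dart) st t (Q : state -> Prop) : ready st -> present d ->
  regs st 5 = d.1.+1 -> regs st 9 = d.2 ->
  regs st 10 + n <= M -> regs st 11 + n <= M -> regs st 12 + n <= M -> 100 <= t ->
  (forall st', kept [:: 0; 1; 3; 5; 9] st st' ->
     regs st' 10 = regs st 10 + (par (dhead d) == Some d.1) * sz (dhead d) ->
     regs st' 11 = regs st 11 + (par d.1 == Some (dhead d)) * sz d.1 ->
     regs st' 12 = (regs st 12).+1 -> Q st') ->
  wp cross t st Q.
Proof.
move=> [hb hm hn] pd h5 h9 b10 b11 b12 ht hQ.
have d1 := ltn_ord d.1; have d2 := ltn_ord d.2; have dh := ltn_ord (dhead d).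
have hslot : mem (4 * d.1.+1 + d.2 - 2) = (dhead d).+1.
  by rewrite (mem_in _ d2) (present_nbr pd).
(* The parent word n + 1 of the root differs from every vertex word, so the test gives 0 there. *)
have sameE (u v : 'I_n) :
    1 - (parent_word par v - u.+1 + (u.+1 - parent_word par v)) = (par v == Some u) :> nat.
  rewrite /parent_word; case: (par v) => [w|]; last first.
    by have := ltn_ord u; rewrite -[None == Some u]/false; lia.
  rewrite (inj_eq (@Some_inj _)) -val_eqE /=; lia.
have le1 (b : bool) x : x <= n -> b * x <= n by case: b; lia.
have l1 := le1 (par (dhead d) == Some d.1) _ (sz_le (dhead d)).
have l2 := le1 (par d.1 == Some (dhead d)) _ (sz_le d.1).
apply: wp_run => //=.
- rewrite /upd /= h5 h9 hm hn hslot !mem_par !mem_sz !sameE; do !split=> //; lia.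
- exact: leq_trans ht.
rewrite /upd /= h5 h9 hm hn hslot !mem_par !mem_sz !sameE => hb'.
apply: hQ => //; last by rewrite /= /upd /= addn1.
split; first by split.
move=> i hi; rewrite /= /upd.
have ni k : k \notin [:: 0; 1; 3; 5; 9] -> i != k by apply: contraNneq => <-.
by rewrite (negPf (ni 11 isT)) (negPf (ni 10 isT)) (negPf (ni 12 isT)) (negPf (ni 6 isT)).
Qed.

Definition inflow (x : dart) : nat := (par (dhead x) == Some x.1) * sz (dhead x).
Definition outflow (x : dart) : nat := (par x.1 == Some (dhead x)) * sz x.1.

Lemma chain_loop p (d : dart) st t (Q : state -> Prop) : ready st -> present d ->
  path cutrel d p -> fwd (last d p) = None ->
  regs st 5 = d.1.+1 -> regs st 9 = d.2 ->
  regs st 10 + n * (size p).+1 <= M -> regs st 11 + n * (size p).+1 <= M ->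
  regs st 12 + n * (size p).+1 <= M -> 700 * (size p).+1 + 10 <= t ->
  (forall st', kept [:: 0; 1; 3] st st' ->
     regs st' 10 = regs st 10 + \sum_(x <- d :: p) inflow x ->
     regs st' 11 = regs st 11 + \sum_(x <- d :: p) outflow x ->
     regs st' 12 = regs st 12 + (size p).+1 -> Q st') ->
  wp (CWhile (EReg 5) (CSeq cross advance)) t st Q.
Proof.
elim: p d st t Q => [|y p IH] d st t Q rd pd hp hl h5 h9 b10 b11 b12 ht hQ.
all: have [hb hm hn] := rd.
all: apply: (@wp_loop M 10 w9 _ _ 600 (t - 602)) => //=; rewrite ?h5 //; last (move: ht => /=; lia).
all: apply: (wp_seq (t1 := 100) (t2 := 500)) => //.
all: rewrite /= in b10 b11 b12 ht; apply: (cross_ok rd pd h5 h9) => //; try nia.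
all: move=> s1 [rd1 k1] e10 e11 e12.
all: apply: (advance_ok (d := d)) => //; rewrite ?k1 //.
all: move=> s2 [rd2 k2] f5 f9; have [hb2 hm2 hn2] := rd2.
  move: f5; rewrite hl /= => f5; apply: wp_exit => //; last by rewrite /=; lia.
  apply: hQ; rewrite ?big_seq1 ?k2 ?e10 ?e11 ?e12 ?addn1 //.
  by split=> // i hi; rewrite k2 ?k1 //; move: hi; rewrite !inE => /or3P[] /eqP ->.
move: hp => /= /andP[/eqP hy hp]; have [_ py _] := fwd_present cs hy.
have [_ _ y2 _] := fwdP cs hy.
have l1 : inflow d <= n by rewrite /inflow; have := sz_le (dhead d); case: (_ == _); lia.
have l2 : outflow d <= n by rewrite /outflow; have := sz_le d.1; case: (_ == _); lia.
have g10 : regs s2 10 = regs st 10 + inflow d by rewrite k2 // e10.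
have g11 : regs s2 11 = regs st 11 + outflow d by rewrite k2 // e11.
have g12 : regs s2 12 = (regs st 12).+1 by rewrite k2 // e12.
move: f5; rewrite hy /= => f5.
apply: (IH y) => //; try (rewrite ?g10 ?g11 ?g12; nia).
  by rewrite f9 y2 val_rs3.
move=> s3 [rd3 k3]; rewrite g10 g11 g12 => j10 j11 j12.
apply: hQ; rewrite ?j10 ?j11 ?j12 ?[\sum_(x <- d :: _) _]big_cons ?addnA //=; last by lia.
split=> // i hi; rewrite k3 // k2 ?k1 //; by move: hi; rewrite !inE => /or3P[] /eqP ->.
Qed.

Hypothesis par_root : forall v, (par v == None) = (v == r).
Hypothesis par_edge : forall u v, par v = Some u -> e u v.
Hypothesis sz_flow : forall v, sz v = (\sum_(c | par c == Some v) sz c).+1.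

Local Notation rooted := (rooted pos e r).
Local Notation cutsize := (cutsize pos e).

Definition cut_edges (D : dart) : nat := #|[set x : dart | connect cutrel D x]|.
Definition gain0 (D : dart) : nat := rooted D * (cutsize D * (n - cutsize D)).
Definition gain1 (D : dart) : nat := rooted D * (cut_edges D * (cutsize D * (n - cutsize D))).

Lemma cut_edges_le D : cut_edges D <= 3 * n.
Proof.
rewrite /cut_edges; apply: leq_trans (max_card _) _.
by rewrite card_prod !card_ord mulnC.
Qed.

Lemma cutsize_le D : cutsize D <= n.
Proof. by rewrite -[n in _ <= n]card_ord max_card. Qed.

Lemma chain_ok (D : dart) st t (Q : state -> Prop) : ready st -> start D ->
  regs st 5 = D.1.+1 -> regs st 9 = D.2 ->
  regs st 0 + n * n <= M -> regs st 1 + 3 * n * (n * n) <= M ->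
  700 * cut_edges D + 200 <= t ->
  (forall st', kept [:: 3] st st' -> regs st' 0 = regs st 0 + gain0 D ->
     regs st' 1 = regs st 1 + gain1 D -> Q st') ->
  wp chain t st Q.
Proof.
move=> [hb hm hn] sD h5 h9 b0 b1 ht hQ.
have [p hp hl] := chain_exists cs D; have pD : present D by case/andP: sD.
have up := path_cutrel_uniq cs hp; have wq := word_quad n_ge3.
have cE : cut_edges D = (size p).+1.
  rewrite /cut_edges -[RHS]/(size (D :: p)) -(card_uniqP up); apply: eq_card => x.
  by rewrite inE (chain_mem _ hp hl).
have sumE F : \sum_(x <- D :: p) F x = \sum_(x : dart | connect cutrel D x) F x.
  by rewrite big_uniq //; apply: eq_bigl => x; rewrite (chain_mem _ hp hl).
have cle := cut_edges_le D; rewrite cE in cle.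
have bigb : n * (size p).+1 <= M.
  apply: leq_trans wq; apply: leq_trans (_ : n * (3 * n) <= _); first by rewrite leq_mul2l cle orbT.
  by nia.
apply: (wp_seq (t1 := 50) (t2 := t - 50)); last by lia.
apply: wp_run => //=.
move=> hb1; set s1 := set_reg _ 12 _ in hb1 *.
have rd1 : ready s1 by split.
apply: (wp_seq (t1 := t - 100) (t2 := 50)); last by lia.
apply: (chain_loop (p := p) (d := D)) => //; try by rewrite /s1 /= /upd /= add0n.
  by rewrite -cE; lia.
move=> s2 [[hb2 hm2 hn2] k2]; rewrite /s1 /= /upd /= !add0n !sumE -cE => e10 e11 e12.
have xE : regs s2 10 - regs s2 11 = if headside D r then 0 else cutsize D.
  by rewrite e10 e11; apply: flow_cut.
set x := regs s2 10 - regs s2 11 in xE.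
have xle : x <= n by rewrite xE; case: ifP => _ //; apply: cutsize_le.
have pE : x * (n - x) = gain0 D.
  by rewrite /gain0 /rooted sD xE; case: headside; rewrite ?mul0n ?mul1n.
have qE : cut_edges D * (x * (n - x)) = gain1 D.
  by rewrite /gain1 /rooted sD xE; case: headside; rewrite ?mul0n ?mul1n ?muln0.
have ple : x * (n - x) <= n * n by apply: leq_mul => //; lia.
have qle : cut_edges D * (x * (n - x)) <= 3 * n * (n * n).
  by apply: leq_mul => //; apply: cut_edges_le.
have k20 : regs s2 0 = regs st 0 by rewrite k2.
have k21 : regs s2 1 = regs st 1 by rewrite k2.
apply: wp_run => //=.
  rewrite /upd /= -/x hn2 k20 k21 e12; do !split=> //; lia.
rewrite /upd /= -/x hn2 k20 k21 e12 qE pE => hb3; apply: hQ => //.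
split; first by split.
by move=> i; rewrite inE => /eqP ->; rewrite /= /upd /= k2.
Qed.

Lemma from_dart_ok (d : dart) st t (Q : state -> Prop) : ready st -> regs st 3 = d.1.+1 ->
  regs st 0 + n * n <= M -> regs st 1 + 3 * n * (n * n) <= M ->
  start d * (700 * cut_edges d) + 700 <= t ->
  (forall st', kept [:: 3] st st' -> regs st' 0 = regs st 0 + gain0 d ->
     regs st' 1 = regs st 1 + gain1 d -> Q st') ->
  wp (from_dart d.2) t st Q.
Proof.
move=> rd h3 b0 b1 ht hQ; have [hb hm hn] := rd.
have d1 := ltn_ord d.1; have d2 := ltn_ord d.2.
have oM o : @o2n n o <= M by apply: leq_trans (o2n_le o) _; lia.
have hslot : mem (4 * d.1.+1 + d.2 - 2) = o2n (nbr d.1 d.2) by rewrite (mem_in _ d2).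
have fd : fits_com 10 (CSet 9 (EConst d.2)) by rewrite /= /fits /=; lia.
have fs : fits_com 10 (CSet 6 (slotx (EReg 3) (EConst d.2))) by rewrite /= /fits /=; lia.
have r3 := rs_lt3 d2.
have fr : fits_com 10 (CSet 8 (EConst (rs d.2))) by rewrite /= /fits /=; lia.
apply: (wp_seq (t1 := 450) (t2 := t - 450)); last by lia.
apply: (wp_seq (t1 := 10) (t2 := 440)) => //.
apply: wp_set => //=; first by rewrite h3; lia.
rewrite h3 => hb1.
apply: (wp_seq (t1 := 10) (t2 := 430)) => //.
apply: wp_set => //=; first by lia.
move=> hb2.
apply: (wp_seq (t1 := 10) (t2 := 420)) => //.
apply: wp_set => //=; first by rewrite /upd /= h3 hm hslot.
rewrite /upd /= h3 hm hslot => hb3.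
apply: (wp_seq (t1 := 10) (t2 := 410)) => //.
apply: wp_set => //=; first exact: oM.
rewrite /upd /= => hb4.
apply: (wp_seq (t1 := 10) (t2 := 400)) => //.
apply: wp_set => //=; first by lia.
move=> hb5; set s5 := set_reg _ 8 _ in hb5 *.
have rd5 : ready s5 by split.
apply: (wp_seq (t1 := 350) (t2 := 50)) => //.
apply: (wp_turns (k := 8) (o := nbr d.1 d.2) (s := rs d.2)) => //.
move=> s6 [hb6 hm6 hn6] e7 _ rest6; apply: wp_run => //= _.
have g6 : regs s6 6 = o2n (nbr d.1 d.2) by rewrite rest6.
have g5 : regs s6 5 = d.1.+1 by rewrite rest6.
have g9 : regs s6 9 = d.2 by rewrite rest6.
have g0 : regs s6 0 = regs st 0 by rewrite rest6.
have g1 : regs s6 1 = regs st 1 by rewrite rest6.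
have g3 : regs s6 3 = regs st 3 by rewrite rest6.
have stop : ~~ start d -> Q s6.
  move=> ns; apply: hQ; rewrite ?g0 ?g1 /gain0 /gain1 /rooted ?(negPf ns) ?addn0 //.
  by split=> // i; rewrite inE => /eqP ->.
apply: (wp_if w9 (t1 := t - 452)) => //=; last by lia.
rewrite g6; case pd: (nbr d.1 d.2) => [j|] /=; last first.
  apply: wp_run => //= [|_]; first by lia.
  by apply: stop; rewrite /start /present pd.
have pd' : present d by rewrite /present pd.
have dj : dhead d = j by rewrite /dhead pd.
have sE : start d = (regs s6 7 == 0).
  have -> : start d = ~~ left_full pos e j (rs d.2) by rewrite /start pd' -val_rs3 -dj.
  by rewrite e7 pd /left_full; case: (iter 8 _ _) => -[].
apply: (wp_if w9 (t1 := t - 454)) => //=; last by lia.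
case: ifP => h7.
  apply: wp_run => //= [|_]; first by lia.
  by apply: stop; rewrite sE.
have sd : start d by rewrite sE (negbFE h7).
rewrite sd mul1n in ht.
apply: (chain_ok (D := d)) => //; rewrite ?g0 ?g1 //; first by lia.
move=> s7 [rd7 k7] f0 f1; apply: hQ => //; split=> // i hi.
by rewrite k7 //; move: hi; rewrite inE => /eqP ->.
Qed.

End Cuts.

Definition ord3 (k : nat) (h : k < 3) : 'I_3 := Ordinal h.

Lemma sum_ord3 (F : 'I_3 -> nat) :
  \sum_(s < 3) F s = F (@ord3 0 isT) + F (@ord3 1 isT) + F (@ord3 2 isT).
Proof.
rewrite !big_ord_recl big_ord0 addn0 addnA.
by congr (F _ + F _ + F _); apply: val_inj.
Qed.

(** * The sum over all cuts and its total running time *)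

Section SumCuts.
Variables (n : nat) (pos : 'I_n -> netv) (e : rel 'I_n) (r : 'I_n).
Hypothesis cs : cut_system pos e.
Variables (par : 'I_n -> option 'I_n) (sz : 'I_n -> nat) (mem : nat -> nat).
Hypothesis mem_in : input_ok pos e mem.
Hypothesis mem_par : forall i : 'I_n, mem (5 * n + i.+1) = parent_word par i.
Hypothesis mem_sz : forall i : 'I_n, mem (7 * n + i.+1) = sz i.
Hypothesis sz_le : forall i, sz i <= n.
Hypothesis par_root : forall v, (par v == None) = (v == r).
Hypothesis par_edge : forall u v, par v = Some u -> e u v.
Hypothesis sz_flow : forall v, sz v = (\sum_(c | par c == Some v) sz c).+1.

Local Notation M := (n ^ 6).
Local Notation wp := (wp M 10).
Local Notation dart := ('I_n * 'I_3)%type.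
Local Notation cutrel := (cutrel pos e).
Local Notation start := (start pos e).
Local Notation gain0 := (gain0 pos e r).
Local Notation gain1 := (gain1 pos e r).
Local Notation ready := (ready n mem).
Local Notation cut_edges := (cut_edges pos e).

Let n_ge3 : 2 < n := cs_size cs.
Let w9 := word9 n_ge3.

Definition dart_time (d : dart) : nat := start d * (700 * cut_edges d) + 700.

Lemma gain0_le d : gain0 d <= n * n.
Proof.
rewrite /gain0; case: (rooted _ _ _ _); rewrite ?mul0n ?mul1n //.
by apply: leq_mul; [apply: cutsize_le | apply: leq_subr].
Qed.

Lemma gain1_le d : gain1 d <= 3 * n * (n * n).
Proof.
rewrite /gain1; case: (rooted _ _ _ _); rewrite ?mul0n ?mul1n //.
by apply: leq_mul; [apply: cut_edges_le | apply: leq_mul; [apply: cutsize_le | apply: leq_subr]].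
Qed.

Lemma word_gains k : k < 3 * n -> k * (n * n) + n * n <= M /\
  k * (3 * n * (n * n)) + 3 * n * (n * n) <= M.
Proof.
move=> hk; have ws := word_size n_ge3.
have e4 : 9 * n ^ 4 = 3 * n * (3 * n * (n * n)).
  by rewrite !expnS expn0 muln1; lia.
rewrite e4 in ws; rewrite -!mulSnr; split; last first.
  by apply: leq_trans ws; rewrite leq_mul2r hk orbT.
apply: leq_trans ws; apply: leq_mul => //; rewrite -[X in X <= _]mul1n leq_mul2r.
by apply/orP; right; lia.
Qed.

(** The bounds multiply the darts already treated, three per vertex, by the largest gain; with
    [word_gains] they leave room for the next gain. *)
Definition loop_inv (t : nat) (st : state) : Prop := exists J,
  [/\ ready st, regs st 3 = J /\ J <= n,
    regs st 0 = \sum_(i < n | J <= i) \sum_(s < 3) gain0 (i, s) /\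
      regs st 0 <= 3 * (n - J) * (n * n),
    regs st 1 = \sum_(i < n | J <= i) \sum_(s < 3) gain1 (i, s) /\
      regs st 1 <= 3 * (n - J) * (3 * n * (n * n)) &
    \sum_(i < n | i < J) \sum_(s < 3) dart_time (i, s) + 20 * J + 10 <= t].

Lemma sum_ge (F : 'I_n -> nat) (i : 'I_n) :
  \sum_(k < n | i <= k) F k = F i + \sum_(k < n | i < k) F k.
Proof.
rewrite (bigD1 i) //=; congr (_ + _); apply: eq_bigl => k.
by rewrite andbC ltn_neqAle val_eqE eq_sym.
Qed.

Lemma sum_lt (F : 'I_n -> nat) (i : 'I_n) :
  \sum_(k < n | k < i.+1) F k = F i + \sum_(k < n | k < i) F k.
Proof.
rewrite (bigD1 i) //=; congr (_ + _); apply: eq_bigl => k.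
by rewrite andbC [RHS]ltn_neqAle val_eqE ltnS.
Qed.

Lemma sum_cuts_ok st t (Q : state -> Prop) : ready st -> regs st 0 = 0 -> regs st 1 = 0 ->
  \sum_(i < n) \sum_(s < 3) dart_time (i, s) + 20 * n + 30 <= t ->
  (forall st', regs st' 0 = \sum_(i < n) \sum_(s < 3) gain0 (i, s) ->
               regs st' 1 = \sum_(i < n) \sum_(s < 3) gain1 (i, s) -> Q st') ->
  wp sum_cuts t st Q.
Proof.
move=> [hb hm hn] h0 h1 ht hQ; have wl := word_lin n_ge3.
apply: (wp_seq (t1 := 10) (t2 := t - 10)); last by lia.
apply: wp_set => //=; first by rewrite hn; lia.
rewrite hn => hb1; apply: (wp_while w9 (Inv := loop_inv)) => //; last first.
  exists n; split=> //.
  - by rewrite /= /upd /= h0 big1 // => i hi; have := ltn_ord i; rewrite ltnNge hi.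
  - by rewrite /= /upd /= h1 big1 // => i hi; have := ltn_ord i; rewrite ltnNge hi.
  have -> : \sum_(i < n | i < n) \sum_(s < 3) dart_time (i, s)
      = \sum_(i < n) \sum_(s < 3) dart_time (i, s).
    by apply: eq_bigl => i; rewrite ltn_ord.
  by lia.
move=> {ht h0 h1 hb1 hb hm hn st t} t st [J [rd [h3 Jn] [h0 l0] [h1 l1] ht]].
have [hb hm hn] := rd; split=> //; rewrite /= h3.
case: J h3 Jn h0 l0 h1 l1 ht => [|J] h3 Jn h0 l0 h1 l1 ht /=.
  by split; [lia | apply: hQ; rewrite ?h0 ?h1].
pose i := Ordinal Jn.
pose d0 : dart := (i, @ord3 0 isT); pose d1 : dart := (i, @ord3 1 isT).
pose d2 : dart := (i, @ord3 2 isT).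
have fok := from_dart_ok cs mem_in mem_par mem_sz sz_le par_root par_edge sz_flow.
rewrite (sum_lt (fun i => \sum_(s < 3) dart_time (i, s)) i) sum_ord3 -/d0 -/d1 -/d2 in ht.
set rest := \sum_(k < n | k < i) _ in ht.
exists (dart_time d0 + (dart_time d1 + (dart_time d2 + 10))), (rest + 20 * J + 10).
split; first by lia.
set k := 3 * (n - J.+1) in l0 l1.
have kn : k.+3 <= 3 * n by rewrite /k; lia.
have [a0 a1] := word_gains (k := k) ltac:(lia).
have [b0 b1] := word_gains (k := k.+1) ltac:(lia).
have [c0 c1] := word_gains (k := k.+2) ltac:(lia).
apply: (wp_seq (t1 := dart_time d0) (t2 := dart_time d1 + (dart_time d2 + 10))) => //.
apply: (fok d0) => //.
- by apply: leq_trans a0; rewrite leq_add2r.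
- by apply: leq_trans a1; rewrite leq_add2r.
move=> s1 [rd1 k1] f0 f1.
have u0 : regs s1 0 <= k.+1 * (n * n) by rewrite f0 mulSn addnC leq_add ?gain0_le.
have u1 : regs s1 1 <= k.+1 * (3 * n * (n * n)) by rewrite f1 mulSn addnC leq_add ?gain1_le.
apply: (wp_seq (t1 := dart_time d1) (t2 := dart_time d2 + 10)) => //.
apply: (fok d1) => //; first by rewrite k1.
- by apply: leq_trans b0; rewrite leq_add2r.
- by apply: leq_trans b1; rewrite leq_add2r.
move=> s2 [rd2 k2] g0 g1.
have v0 : regs s2 0 <= k.+2 * (n * n) by rewrite g0 mulSn addnC leq_add ?gain0_le.
have v1 : regs s2 1 <= k.+2 * (3 * n * (n * n)) by rewrite g1 mulSn addnC leq_add ?gain1_le.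
apply: (wp_seq (t1 := dart_time d2) (t2 := 10)) => //.
apply: (fok d2) => //; first by rewrite k2 // k1.
- by apply: leq_trans c0; rewrite leq_add2r.
- by apply: leq_trans c1; rewrite leq_add2r.
move=> s3 [rd3 k3] j0 j1; have [hb3 hm3 hn3] := rd3.
have q3 : regs s3 3 = J.+1 by rewrite k3 // k2 // k1 // h3.
apply: wp_set => //=; first by rewrite q3; lia.
rewrite q3 subn1 /= => hb4; exists J.
have kE : 3 * (n - J) = k.+3 by rewrite /k; lia.
split=> //.
- by split=> //; apply: ltnW.
- rewrite /= /upd /= kE (sum_ge (fun i => \sum_(s < 3) gain0 (i, s)) i) sum_ord3 -/d0 -/d1 -/d2.
  split; last first.
    by rewrite j0 mulSn addnC leq_add ?gain0_le.
  rewrite -[\sum_(k < n | i < k) _]h0 j0 g0 f0; lia.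
- rewrite /= /upd /= kE (sum_ge (fun i => \sum_(s < 3) gain1 (i, s)) i) sum_ord3 -/d0 -/d1 -/d2.
  split; last first.
    by rewrite j1 mulSn addnC leq_add ?gain1_le.
  rewrite -[\sum_(k < n | i < k) _]h1 j1 g1 f1; lia.
Qed.

(** A dart lies on the chain of at most one starting dart, so the lengths of the chains add up to at
    most 3n. The walks thus contribute 700 * 3n, and the tests of the 3n darts as much again. *)
Lemma dart_time_sum : \sum_(i < n) \sum_(s < 3) dart_time (i, s) <= 4200 * n.
Proof.
rewrite pair_bigA /= /dart_time (eq_bigr (fun d : dart => start d * (700 * cut_edges d) + 700));
  last by case.
rewrite big_split /= sum_nat_const card_prod !card_ord.
have H : \sum_(d : dart) start d * cut_edges d <= 3 * n.
  have -> : \sum_(d : dart) start d * cut_edges d =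
      \sum_(x : dart) \sum_(d : dart) (start d && connect cutrel d x).
    rewrite exchange_big; apply: eq_bigr => d _; rewrite /cut_edges -sum1_card big_distrr /=.
    rewrite big_mkcond; apply: eq_bigr => x _; rewrite inE.
    by case: (start d); case: connect.
  apply: leq_trans (_ : \sum_(x : dart) 1 <= _); last first.
    by rewrite sum_nat_const card_prod !card_ord muln1 mulnC.
  apply: leq_sum => x _.
  case: (pickP (fun d => start d && connect cutrel d x)) => [d /andP[sd cd]|h].
    rewrite (bigD1 d) //= big1 ?addn0 ?leq_b1 // => d' dd'.
    apply/eqP; rewrite eqb0; apply: contra dd' => /andP[sd' cd'].
    by apply/eqP; apply: start_unique cd' cd.
  by rewrite big1 // => d _; rewrite h.
have -> : \sum_(d : dart) start d * (700 * cut_edges d) = 700 * \sum_(d : dart) start d * cut_edges d.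
  by rewrite big_distrr; apply: eq_bigr => d _ /=; rewrite mulnCA.
lia.
Qed.

End SumCuts.

(** * The whole run *)

Lemma nth_flatten4 (T : Type) (F : T -> seq nat) (x0 : T) l k m :
  (forall x, size (F x) = 4) -> k < size l -> m < 4 ->
  nth 0 (flatten [seq F x | x <- l]) (4 * k + m) = nth 0 (F (nth x0 l k)) m.
Proof.
move=> hF + hm; elim: l k => [|x l IH] [|k] //= hk; rewrite nth_cat hF.
  by rewrite muln0 add0n hm.
by rewrite ltnNge mulnS -addnA leq_addr /= addKn IH.
Qed.

Section Whole.
Variables (n : nat) (pos : 'I_n -> netv) (e : rel 'I_n).
Hypothesis cs : cut_system pos e.

Local Notation M := (n ^ 6).
Local Notation wp := (wp M 10).

Let n_ge3 : 2 < n := cs_size cs.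
Let r : 'I_n := Ordinal (ltn_trans (isT : 0 < 2) n_ge3).

Lemma slot_nbr i s : slot pos e i s = o2n (nbr pos e i s).
Proof. by []. Qed.

Lemma encode_slot (i : 'I_n) s : s < 3 ->
  nth 0 (encode pos e) (4 * i.+1 + s - 2) = o2n (nbr pos e i s).
Proof.
move=> hs; rewrite /encode; have -> : 4 * i.+1 + s - 2 = (4 * i + s.+1).+1 by lia.
rewrite /= (@nth_flatten4 _ _ i) //; last by rewrite size_enum_ord.
rewrite nth_ord_enum; by case: s hs => [|[|[|]]].
Qed.

Lemma size_encode : size (encode pos e) = (4 * n).+1.
Proof.
rewrite /= size_flatten /shape -map_comp.
rewrite (eq_map (g := fun=> 4)) //; have -> : 4 * n = 4 * size (enum 'I_n) by rewrite size_enum_ord.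
by congr _.+1; elim: (enum 'I_n) => //= x l ->; rewrite mulnS.
Qed.

Lemma encode_out a : 4 * n < a -> nth 0 (encode pos e) a = 0.
Proof. by move=> h; rewrite nth_default // size_encode. Qed.

Lemma encode_le a : nth 0 (encode pos e) a <= n.
Proof.
have [h|h] := ltnP (4 * n) a; first by rewrite encode_out.
case: a h => [|a] h; first by rewrite /encode.
have hk : a %/ 4 < n by lia.
have -> : a.+1 = (4 * (a %/ 4) + a %% 4).+1 by lia.
rewrite /encode /= (@nth_flatten4 _ _ (Ordinal hk)) ?size_enum_ord ?ltn_mod //.
move: (nth (Ordinal hk) _ _) => i; rewrite !slot_nbr.
have hc : corner (pos i) < 4 by apply: ltn_ord.
have [h0 h1 h2] := And3 (o2n_le (nbr pos e i 0)) (o2n_le (nbr pos e i 1)) (o2n_le (nbr pos e i 2)).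
by case: (a %% 4) => [|[|[|[|m]]]] //=; rewrite ?nth_nil //; lia.
Qed.

Lemma init_ok t (Q : state -> Prop) : 100 <= t ->
  (forall st, bfs_inv pos e r [:: r] 0 st -> Q st) -> wp init t (input pos e) Q.
Proof.
move=> ht hQ; have wl := word_lin n_ge3; have w9 := word9 n_ge3.
have hb : bounded M (input pos e).
  by split=> //= a; have := encode_le a; rewrite /encode /=; lia.
have en : nth 0 (encode pos e) 0 = n by [].
apply: wp_run => //.
- by rewrite /= /upd /= -/(encode pos e); do !split=> //; lia.
- exact: leq_trans ht.
rewrite /= /upd /= => hb'; set st := set_reg _ 4 _ in hb' *.
have rm a : ram st a = if a == 9 * n + 0 then 1 else if a == 5 * n + 1 then n + 1
   else nth 0 (encode pos e) a by [].
apply: hQ; split=> //.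
- move=> i s hs; rewrite rm; have := ltn_ord i => hi.
  by do 2 (case: eqP => [|_]; first by lia); apply: encode_slot.
- by case=> [|k] // _; rewrite rm eqxx.
- move=> i; rewrite inE => hi; rewrite rm.
  have hi' : i != 0 :> nat by apply: contra hi => /eqP i0; apply/eqP/val_inj.
  have := ltn_ord i; do 2 (case: eqP => [|_]; first by lia).
  by rewrite encode_out //; lia.
- by rewrite rm /=; case: eqP => [|_]; [lia|rewrite eqxx addn1].
- by case=> [|[|k]].
- move=> a ha; rewrite rm; do 2 (case: eqP => [|_]; first by lia).
  by rewrite encode_out //; lia.
Qed.

(** The phases take at most 100, 300 n + 100, 110 n + 10 and 4220 n + 30 steps, together at most
    5000 n because n >= 3. *)
Lemma index_program_ok : wp index_program (5000 * n) (input pos e) (fun st =>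
  regs st 0 = wiener e /\ regs st 1 = szeged e).
Proof.
apply: (wp_seq (t1 := 100) (t2 := 5000 * n - 100)); last by lia.
apply: init_ok => // s1 B1.
apply: (wp_seq (t1 := 300 * n + 100) (t2 := 4700 * n - 200)); last by lia.
apply: (wp_weaken (search_ok cs B1 (leqnn _))) => // s2 [q B2 sq].
have [par T hpar] := bfs_tree B2 sq.
have mq k : k < n -> ram s2 (9 * n + k) = (nth r q k).+1.
  by move=> hk; apply: (bi_q B2); rewrite sq.
have C2 : count_inv q par (ram s2) n s2.
  have z (i : 'I_n) : size_at (ram s2) i = 0.
    have hi := ltn_ord i; rewrite /size_at (bi_zero B2) //. lia.
  have idx (i : 'I_n) : (n <= index i q) = false.
    by rewrite leqNgt -[X in _ < X]sq index_mem (tr_all T).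
  split=> //; try by [apply: bi_bnd B2|apply: bi_n B2|apply: bi_out B2].
  - by split; [apply: bi_h B2|].
  - by move=> _; rewrite (bi_zero B2) //; lia.
  - by move=> i; rewrite z idx big1.
  - by rewrite big1.
  - by move=> i; rewrite z.
apply: (wp_seq (t1 := 110 * n + 10) (t2 := 4590 * n - 210)); last by lia.
apply: (wp_weaken (count_ok cs T mq hpar C2 (leqnn _))) => // s3 C3.
have n3 := n_ge3.
have hin : input_ok pos e (ram s3).
  move=> i s hs; rewrite (ci_mem C3); last by have := ltn_ord i; lia.
  exact: bi_in B2 i s hs.
have hp3 (i : 'I_n) : ram s3 (5 * n + i.+1) = parent_word par i.
  by rewrite (ci_mem C3) ?hpar //; have := ltn_ord i; lia.
have hs3 (i : 'I_n) : ram s3 (7 * n + i.+1) = size_at (ram s3) i by [].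
have flow v : size_at (ram s3) v = (\sum_(c | par c == Some v) size_at (ram s3) c).+1.
  rewrite {1}(ci_flow C3) leq0n add1n; congr _.+1; apply: eq_bigl => c.
  by rewrite leq0n andbT.
have [o0 o1] := ci_out C3.
apply: (sum_cuts_ok cs hin hp3 hs3 (ci_le C3) (tr_root T) (@tr_edge _ _ _ _ _ T) flow) => //.
- by split=> //; [apply: ci_bnd C3|apply: ci_n C3].
- by have := dart_time_sum cs; lia.
move=> s4 -> ->; rewrite (wiener_cuts r cs) (szeged_cuts r cs) !pair_bigA /=; split.
  by rewrite [RHS]big_mkcond; apply: eq_bigr => -[i s] _; rewrite /gain0 /=; case: rooted; rewrite ?mul1n.
by rewrite [RHS]big_mkcond; apply: eq_bigr => -[i s] _; rewrite /gain1 /=; case: rooted; rewrite ?mul1n.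
Qed.

End Whole.

Theorem theorem4p5 :
  exists (P : com) (c d : nat),
    forall (n : nat) (pos : 'I_n -> netv) (e : rel 'I_n),
      C4C8_system pos e ->
      exists (t : nat) (s : state),
        [/\ exec (n ^ d) P (input pos e) t s,
            t <= c * n,
            regs s 0 = wiener e
          & regs s 1 = szeged e].
Proof.
(* Stored words are at most n^6 and expressions have degree at most 10, whence the exponent 60. *)
exists index_program, 5000, 60 => n pos e /C4C8_cut_system cs.
have [t [s [he ht [h0 h1]]]] := index_program_ok cs; exists t, s; split=> //.
by rewrite -[60]/(6 * 10) expnM.
Qed.
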